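(* Let $0<s<+\infty$ and $\beta>-1$. If $f\in H_\beta^s(\mathbb D)$ then $f\in\mathcal A^s(\mathbb D,\mu_{\alpha,\beta})$ for every $\alpha>-1$. Moreover, $$\lim_{\alpha\to(-1)^+}\|f\|_{\mathcal A^s(\mathbb D,\mu_{\alpha,\beta})}=\|f\|_{H_\beta^s(\mathbb D)}.$$
   Context: $\mathbb N=\{0,1,2,\dots\}$, $\mathbb D$ is the unit disk, $\mathbb D^*=\mathbb D\setminus\{0\}$, $dA(z)=\frac1\pi\,dx\,dy$, $\mathscr B$ is the beta function. For $\alpha,\beta>-1$, $\mu_{\alpha,\beta}$ is the probability measure on $\mathbb D$ given by $d\mu_{\alpha,\beta}(z)=\frac{|z|^{2\beta}(1-|z|^2)^\alpha}{\mathscr B(\alpha+1,\beta+1)}dA(z)$. $\mathcal A^s(\mathbb D,\mu_{\alpha,\beta})$ is the space of holomorphic functions $f$ on $\mathbb D^*$ with $\|f\|_{\mathcal A^s(\mathbb D,\mu_{\alpha,\beta})}^s:=\int_{\mathbb D}|f|^s\,d\mu_{\alpha,\beta}<\infty$. Set $\eta_{s,\beta}=\left\lfloor\frac{2(\beta+1)}{s}\right\rfloor$ if $\frac{2(\beta+1)}{s}\notin\mathbb N$ and $\eta_{s,\beta}=\frac{2(\beta+1)}{s}-1$ if $\frac{2(\beta+1)}{s}\in\mathbb N$. The modified Hardy space $H_\beta^s(\mathbb D)$ is the set of all holomorphic functions $f$ on $\mathbb D^*$ such that $0$ is a removable singularity of $f$ (in which case $\eta=\eta(f)=0$) or a pole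 of order $\eta=\eta(f)\le\eta_{s,\beta}$, and $$\|f\|_{H_\beta^s(\mathbb D)}^s:=\sup_{0<r<1}\frac{r^{s\eta}}{2\pi}\int_0^{2\pi}|f(re^{i\theta})|^s\,d\theta<+\infty.$$ *)

(* Defs.v *)
From HB Require Import structures.
From mathcomp Require Import all_boot all_order all_algebra.
From mathcomp Require Import complex.
From mathcomp Require Import all_classical all_reals all_analysis.
From mathcomp Require Import measurable_realfun.
Import numFieldNormedType.Exports.
Import Order.TTheory GRing.Theory Num.Theory.

Set Implicit Arguments.
Unset Strict Implicit.
Unset Printing Implicit Defensive.

Local Open Scope classical_set_scope.
Local Open Scope complex_scope.
Local Open Scope ring_scope.

Lemma vanish_order (K : numFieldType) (g h : K^o -> K^o) k : (0 < k)%N ->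
  derivable g 0 1 -> derivable h 0 1 ->
  (forall z, `|z| < 1 -> z != 0 -> g z = h z * z ^+ k) -> g 0 = 0.
Proof.
move=> k0 /derivable1_diffP/differentiable_continuous cg.
move=> /derivable1_diffP/differentiable_continuous ch gh.
have dg : g z @[z --> 0^'] --> g 0 by apply: cvg_trans cg; exact/cvg_app/cvg_within.
have dh : h z @[z --> 0^'] --> h 0 by apply: cvg_trans ch; exact/cvg_app/cvg_within.
have dx : (z : K^o) ^+ k @[z --> (0 : K^o)^'] --> (0 : K^o) ^+ k.
  elim: (k) => [|j IH]; first exact: cvg_cst.
  under eq_fun do rewrite exprS.
  by rewrite exprS; apply: cvgM IH; exact: cvg_within.
have hx := cvgM dh dx; rewrite expr0n gtn_eqF// mulr0 in hx.
have E : \forall z \near (0 : K^o)^', h z * z ^+ k = g z.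
  near=> z; rewrite gh//.
  - by near: z; exact: dnbhs0_lt ltr01.
  - by near: z; exact: nbhs_dnbhs_neq.
have hg : g z @[z --> (0 : K^o)^'] --> (0 : K^o).
  by move=> P /hx; apply: filterS2 E => z /= <-.
have pF : ProperFilter (g z @[z --> (0 : K^o)^']).
  by apply: fmap_proper_filter; exact: (@Proper_dnbhs_numFieldType K).
exact: (cvg_unique (@norm_hausdorff _ _) dg hg).
Unshelve. all: by end_near. Qed.

Section ModifiedHardy.
Context {R : realType}.
Local Notation C := (R[i]).
Local Notation R2 := (measurableTypeR R * measurableTypeR R)%type.

(* The norm of R[i] as a numeric field takes its values in R[i] itself; normc
   is its R-valued version. *)
Definition absc (z : C) : R := ComplexField.Normc.normc z.

Definition expi (t : R) : C := cos t +i* sin t.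

Definition toC (p : R2) : C := p.1 +i* p.2.

Definition disk : set C := [set z | absc z < 1].

Definition pdisk : set C := disk `\ 0.

(* Complex differentiability at every point of U, for U open.  The alias ^o
   carries the normed space structure of R[i] over itself. *)
Definition holomorphic (U : set C) (f : C -> C) : Prop :=
  forall z, U z -> derivable (f : C^o -> C^o) z 1.

(* Functions on the punctured disk are total functions on R[i] whose values
   outside of pdisk are irrelevant. *)
Definition removable0 (f : C -> C) : Prop :=
  exists2 g, holomorphic disk g & forall z, pdisk z -> f z = g z.

Definition pole0 (f : C -> C) (n : nat) : Prop :=
  exists g, [/\ holomorphic disk g, g 0 != 0 &
    forall z, pdisk z -> f z = g z / z ^+ n].

Definition sing_order (f : C -> C) (n : nat) : Prop :=
  if n is 0%N then removable0 f else pole0 f n.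

Lemma sing_order_uniq (f : C -> C) m n :
  sing_order f m -> sing_order f n -> m = n.
Proof.
wlog mn : m n / (m < n)%N => [hw fm fn|].
  by have [/hw->|/hw->|] := ltngtP m n.
case: n mn => // n mn fm [g [gh /eqP g0 fg]]; exfalso.
have [h hh fh] : exists2 h, holomorphic disk h &
    forall z, pdisk z -> f z = h z / z ^+ m.
  case: m mn fm => [|m] _ /= [h]; last by case=> ? _ ?; exists h.
  by move=> hh fh; exists h => // z /fh ->; rewrite expr0 divr1.
have d0 : disk (0 : C) by rewrite /disk/= /absc /= expr0n addr0 sqrtr0 ltr01.
apply: g0; apply: (@vanish_order C g h (n.+1 - m)).
- by rewrite subn_gt0.
- exact: gh.
- exact: hh.
move=> z z1 z0; have zD : pdisk z.
  by split => [|/=]; [rewrite /disk/= /absc -ltcR|exact/eqP].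
have := fg _ zD; rewrite (fh _ zD) => e.
have -> : g z = g z / z ^+ n.+1 * z ^+ n.+1 by rewrite divfK ?expf_neq0.
by rewrite -e -[in LHS](subnK (ltnW mn)) addnC exprD mulrA divfK ?expf_neq0.
Qed.

(* By sing_order_uniq there is no actual choice; the default value is only taken
   when the singularity at 0 is essential. *)
Definition eta (f : C -> C) : nat := xget 0%N [set n | sing_order f n].

Definition eta_bound (s beta : R) : int :=
  let q := 2 * (beta + 1) / s in
  if q \is a Num.nat then Num.floor q - 1 else Num.floor q.

Definition betaf (a b : R) : R :=
  \int[lebesgue_measure]_(t in `]0, 1[) (t `^ (a - 1) * (1 - t) `^ (b - 1)).

Lemma invpi_ge0 : 0 <= pi^-1 :> R.
Proof. by rewrite invr_ge0 pi_ge0. Qed.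

Definition dA : {measure set R2 -> \bar R} :=
  mscale (NngNum invpi_ge0)
    (lebesgue_measure \x lebesgue_measure)%E.

Definition mu_density (alpha beta : R) (p : R2) : R :=
  absc (toC p) `^ (2 * beta) * (1 - absc (toC p) ^+ 2) `^ alpha
  / betaf (alpha + 1) (beta + 1).

Definition mu (alpha beta : R) (A : set R2) : \bar R :=
  (\int[dA]_(p in A `&` toC @^-1` disk) (mu_density alpha beta p)%:E)%E.

Lemma absc_ge0 z : 0 <= absc z.
Proof. by case: z => a b; exact: sqrtr_ge0. Qed.

Lemma betaf_ge0 a b : 0 <= betaf a b.
Proof.
by apply: Rintegral_ge0 => t _; rewrite mulr_ge0 ?powR_ge0.
Qed.

Lemma mu_density_ge0 alpha beta p : 0 <= mu_density alpha beta p.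
Proof. by rewrite divr_ge0 ?betaf_ge0// mulr_ge0 ?powR_ge0. Qed.

Lemma measurable_absc : measurable_fun [set: R2] (fun p => absc (toC p)).
Proof.
rewrite /absc /toC /=.
apply: (@measurableT_comp _ _ _ _ _ _ (@Num.sqrt R)).
  by apply: continuous_measurable_fun; exact: sqrt_continuous.
apply: measurable_funD; apply: measurable_funX.
- exact: measurable_fst.
- exact: measurable_snd.
Qed.

Lemma measurable_preim_disk : measurable (toC @^-1` disk).
Proof.
rewrite -[X in measurable X]setTI.
have -> : toC @^-1` disk = (fun p => absc (toC p)) @^-1` `]-oo, 1[.
  by apply/seteqP; split => p /=; rewrite in_itv.
by apply: measurable_absc.
Qed.

Lemma measurable_mu_density alpha beta :
  measurable_fun [set: R2] (mu_density alpha beta).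
Proof.
apply: measurable_funM; last exact: measurable_cst.
apply: measurable_funM.
  by apply: (measurableT_comp (measurable_powR _)); exact: measurable_absc.
apply: (measurableT_comp (measurable_powR _)).
apply: measurable_funB; first exact: measurable_cst.
by apply: measurable_funX; exact: measurable_absc.
Qed.

Section mu_measure.
Variables alpha beta : R.

Let mu0 : mu alpha beta set0 = 0%E.
Proof. by rewrite /mu set0I integral_set0. Qed.

Let mu_ge0 A : (0 <= mu alpha beta A)%E.
Proof. by apply: integral_ge0 => p _; rewrite lee_fin mu_density_ge0. Qed.

Let mu_sigma_additive : semi_sigma_additive (mu alpha beta).
Proof.
move=> F mF tF mUF; rewrite /mu setI_bigcupl.
have mFI n : measurable (F n `&` toC @^-1` disk).
  by apply: measurableI => //; exact: measurable_preim_disk.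
rewrite ge0_integral_bigcup//=.
- apply: is_cvg_ereal_nneg_natsum_cond => n _ _.
  by apply: integral_ge0 => p _; rewrite lee_fin mu_density_ge0.
- by apply/measurable_funTS/measurable_EFinP; exact: measurable_mu_density.
- by move=> p _; rewrite lee_fin mu_density_ge0.
- by apply: trivIset_setIr.
Qed.

HB.instance Definition _ := isMeasure.Build _ _ _ (mu alpha beta)
  mu0 mu_ge0 mu_sigma_additive.

End mu_measure.

Definition bergman_norm (s alpha beta : R) (f : C -> C) : \bar R :=
  ((\int[mu alpha beta]_(p in toC @^-1` disk) (absc (f (toC p)) `^ s)%:E)
    `^ s^-1)%E.

Definition bergman (s alpha beta : R) : set (C -> C) :=
  [set f | holomorphic pdisk f /\ (bergman_norm s alpha beta f < +oo)%E].

Definition circle_mean (s : R) (f : C -> C) (r : R) : \bar R :=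
  ((r `^ (s * (eta f)%:R) / (2 * pi))%:E *
   \int[lebesgue_measure]_(t in `[0%R, (2 * pi)%R])
     (absc (f (r%:C * expi t)%R) `^ s)%:E)%E.

Definition hardy_norm (s : R) (f : C -> C) : \bar R :=
  (ereal_sup [set circle_mean s f r | r in `]0%R, 1%R[] `^ s^-1)%E.

Definition hardy (s beta : R) : set (C -> C) :=
  [set f | [/\ holomorphic pdisk f,
               sing_order f (eta f),
               (eta f)%:Z <= eta_bound s beta &
               (hardy_norm s f < +oo)%E]].

End ModifiedHardy.

(* Main.v *)
Require Import Defs.
From HB Require Import structures.
From mathcomp Require Import all_boot all_order all_algebra.
From mathcomp Require Import complex.
From mathcomp Require Import all_classical all_reals all_analysis.
From mathcomp Require Import measurable_realfun ring lra.
Import numFieldNormedType.Exports.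
Import Order.TTheory GRing.Theory Num.Theory.
Set Implicit Arguments.
Unset Strict Implicit.
Unset Printing Implicit Defensive.
Local Open Scope classical_set_scope.
Local Open Scope complex_scope.
Local Open Scope ring_scope.
Local Notation Re := complex.Re.
Local Notation Im := complex.Im.

(** Write f = g / z ^ n on the punctured disk, with g holomorphic on the whole
    disk and n the order of the singularity.  Let M r be the mean of |g| ^ s
    over the circle of radius r.  The factor r ^ (s * n) in the Hardy norm
    cancels the modulus of z ^ n, so the s-th power of the Hardy norm of f is
    the supremum of M over ]0, 1[.  In polar coordinates with x = 1 - |z| ^ 2
    the s-th power of the Bergman norm is the integral over ]0, 1[ of

      x ^ alpha * (1 - x) ^ (beta - s * n / 2) * M (sqrt (1 - x))

    divided by the beta function at (alpha + 1, beta + 1) ([bergman_int_polar]).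
    The bound on the order of the pole says that s * n < 2 * (beta + 1)
    ([eta_boundP]): the exponent of 1 - x exceeds -1, and as M is bounded the
    integral is finite.  When alpha tends to -1 the beta function blows up
    ([beta_integral_blowup]) while the part of the integral away from x = 0 stays bounded ([beta_tail]),
    so the weight concentrates at x = 0, that is, on the unit circle.  There the
    factor (1 - x) ^ (- s * n / 2) tends to 1 and M, which is nondecreasing,
    tends to its supremum ([bergman_int_cvg]).

    The monotonicity of M ([power_mean_mono]) expresses that |g| ^ s is
    subharmonic.  Goursat's theorem for rectangles ([Goursat], by bisection),
    applied to g (p + exp w), gives the mean value property of holomorphic
    functions ([mean_value_Re]).  Near a point p where g p is not 0, the
    quotient g / g p has values in the right half-plane, and iterated square
    roots write it as h ^ (2 ^ N) with h holomorphic.  Bernoulli's inequality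
    1 + q * (|h| - 1) <= |h| ^ q, for q = s * 2 ^ N > 1, then turns the mean
    value property of h into the sub-mean value property of |g| ^ s at p
    ([submean_powR]).  Replacing |g| by max (|g|, e) extends it to zeros of g and
    makes the admissible radii uniform along a circle ([submean_trunc]).  The
    means of the truncated power over circles around 0 form a radial function
    with the same property, and the maximum principle makes it nondecreasing in
    the radius ([trunc_mean_mono]); e then tends to 0.

    Polar coordinates ([polar_integral]) follow from two facts on area: it is
    invariant under rotations, as a product of three shears
    ([integral_rotation]), and its image under z |-> 1 - |z| ^ 2 is pi times
    length below 1 ([pushforward_radial]).  Averaging an integral over all
    rotations replaces the integrand by its circle means, which are functions of
    |z|. *)

(** * Modulus and polar form *)

Section ModulusAlgebra.
Context {R : realType}.
Local Notation C := (R[i]).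
Implicit Types (z w : C) (t r : R).

Lemma abscM z w : absc (z * w) = absc z * absc w.
Proof. exact: ComplexField.Normc.normcM. Qed.

Lemma abscD z w : absc (z + w) <= absc z + absc w.
Proof. exact: le_normcD. Qed.

Lemma abscN z : absc (- z) = absc z.
Proof. exact: normcN. Qed.

Lemma abscC z w : absc (z - w) = absc (w - z).
Proof. by rewrite -abscN opprB. Qed.

Lemma absc0 : absc (0 : C) = 0.
Proof. exact: ComplexField.Normc.normc0. Qed.

Lemma absc1 : absc (1 : C) = 1.
Proof. exact: ComplexField.Normc.normc1. Qed.

Lemma absc_eq0 z : (absc z == 0) = (z == 0).
Proof.
apply/eqP/eqP => [|->]; last exact: absc0.
exact: ComplexField.Normc.eq0_normc.
Qed.

Lemma absc_gt0 z : (0 < absc z) = (z != 0).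
Proof. by rewrite lt_neqAle absc_ge0 andbT eq_sym absc_eq0. Qed.

Lemma abscX z n : absc (z ^+ n) = absc z ^+ n.
Proof. by elim: n => [|n IH]; rewrite ?expr0 ?absc1// !exprS abscM IH. Qed.

Lemma abscV z : absc z^-1 = (absc z)^-1.
Proof. exact: ComplexField.Normc.normcV. Qed.

Lemma absc_real r : absc r%:C = `|r|.
Proof. by rewrite /absc /= expr0n addr0 sqrtr_sqr. Qed.

Lemma absc_sqr z : absc z ^+ 2 = Re z ^+ 2 + Im z ^+ 2.
Proof. by case: z => a b; rewrite sqr_sqrtr //= addr_ge0 ?sqr_ge0. Qed.

Lemma absc_Re z : `|Re z| <= absc z.
Proof.
by rewrite -(@ler_pXn2r _ 2)// ?nnegrE ?absc_ge0// absc_sqr real_normK ?num_real// lerDl sqr_ge0.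
Qed.

Lemma absc_Im z : `|Im z| <= absc z.
Proof.
by rewrite -(@ler_pXn2r _ 2)// ?nnegrE ?absc_ge0// absc_sqr real_normK ?num_real// lerDr sqr_ge0.
Qed.

Lemma absc_le_ReIm z : absc z <= `|Re z| + `|Im z|.
Proof.
rewrite -(@ler_pXn2r _ 2)// ?nnegrE ?absc_ge0 ?addr_ge0// absc_sqr sqrrD.
rewrite !real_normK ?num_real//.
by rewrite -addrA lerD2l lerDr mulrn_wge0// mulr_ge0.
Qed.

Lemma le_abscB z w : absc z - absc w <= absc (z - w).
Proof. by rewrite lerBlDr (le_trans _ (abscD _ _))// subrK. Qed.

Lemma le_norm_abscB z w : `|absc z - absc w| <= absc (z - w).
Proof. by rewrite ler_norml lerNl opprB {1}abscC !le_abscB. Qed.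

Lemma absc_expi t : absc (expi t) = 1.
Proof. by rewrite /absc /= cos2Dsin2 sqrtr1. Qed.

Lemma expiD t r : expi (t + r) = expi t * expi r.
Proof. by rewrite /expi cosD sinD; simpc; congr (_ +i* _); rewrite addrC. Qed.

Lemma expi0 : expi 0 = 1 :> C.
Proof. by rewrite /expi cos0 sin0. Qed.

Lemma expi_per t : expi (t + 2 * pi) = expi t :> C.
Proof. by rewrite /expi mulr_natl cosD2pi sinD2pi. Qed.

Lemma polar_form z : exists t, 0 <= t <= 2 * pi /\ z = (absc z)%:C * expi t.
Proof.
have pi0 : 0 <= pi :> R := pi_ge0 R.
have [->|z0] := eqVneq z 0.
  by exists 0; rewrite lexx mulr_ge0// absc0 mul0r.
have r0 : 0 < absc z by rewrite absc_gt0.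
set x := Re z / absc z; set y := Im z / absc z.
have xy : x ^+ 2 + y ^+ 2 = 1.
  by rewrite !exprMn -mulrDl -absc_sqr exprVn divff// expf_neq0// gt_eqF.
have x1 : -1 <= x <= 1.
  rewrite -ler_norml -(@ler_pXn2r _ 2)// ?nnegrE//.
  by rewrite real_normK ?num_real// expr1n -xy lerDl sqr_ge0.
have sx : Num.sqrt (1 - x ^+ 2) = `|y|.
  by rewrite -xy addrAC subrr add0r sqrtr_sqr.
have zE : z = (absc z)%:C * (x +i* y).
  have rK a : absc z * (a / absc z) = a by rewrite mulrC divfK ?gt_eqF.
  by simpc; rewrite !rK; case: (z).
have [y0|y0] := leP 0 y.
  exists (acos x); split.
    rewrite acos_ge0//= (le_trans (acos_lepi x1))//.
    by rewrite ler_peMl// ler1n.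
  by rewrite {1}zE /expi acosK ?in_itv//= sin_acos// sx ger0_norm.
exists (- acos x + 2 * pi); split.
  rewrite addrC subr_ge0 gerBl acos_ge0// andbT (le_trans (acos_lepi x1))//.
  by rewrite ler_peMl// ler1n.
rewrite expi_per {1}zE /expi cosN sinN acosK ?in_itv//= sin_acos// sx.
by rewrite ltr0_norm// opprK.
Qed.
End ModulusAlgebra.

(** * Complex derivatives *)

Section ComplexDerivative.
Context {R : realType}.
Local Notation C := (R[i]).
Implicit Types (z w d : C) (f g : C -> C).

(** The derivative of the normed space structure measures errors inside the
    complex numbers; the first-order expansion in terms of the real-valued
    modulus keeps all estimates in R. *)
Definition cderiv f z d := forall e : R, 0 < e -> exists2 k : R, 0 < k &
  forall h, absc h < k -> absc (f (z + h) - f z - d * h) <= e * absc h.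

Definition ccont f z := forall e : R, 0 < e -> exists2 k : R, 0 < k &
  forall w, absc (w - z) < k -> absc (f w - f z) < e.

Lemma derivable_cderiv f z :
  derivable (f : C^o -> C^o) z 1 -> exists d, cderiv f z d.
Proof.
move=> /cvg_ex[/= d fd]; exists d => e e0.
have e0' : 0 < e%:C by rewrite ltcR.
move/cvgrPdist_le : fd => /(_ _ e0').
move=> /nbhs_ballP[k /= k0 kP].
have [Rek Imk] : 0 < Re k /\ Im k = 0.
  by move: k0; rewrite ltcE/= => /andP[/eqP].
exists (Re k) => // h hk.
have [->|h0] := eqVneq h 0.
  by rewrite addr0 subrr mulr0 subr0 absc0 mulr0.
have := kP h _ h0.
rewrite -ball_normE /= sub0r normrN.
have -> : `|h| < k.
  have -> : k = (Re k)%:C by rewrite [LHS]complexE Imk mulr0 addr0.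
  by rewrite ltcR.
move=> /(_ isT).
rewrite -[`|_|]/((absc _)%:C) lecR => A.
rewrite abscC -ler_pdivrMr ?absc_gt0// -abscV -abscM.
suff -> : (d * h - (f (z + h) - f z)) / h = d - h^-1 *: (f (h *: 1 + z) - f z) by [].
rewrite mulrBl mulfK// /GRing.scale/= mulr1 [h + z]addrC; congr (_ - _).
by rewrite mulrC.
Qed.

Lemma cderiv_ccont f z d : cderiv f z d -> ccont f z.
Proof.
move=> fd e e0.
have [k k0 kP] := fd 1 ltr01.
have K0 : 0 < 1 + absc d by rewrite ltr_pwDl// absc_ge0.
exists (Num.min k (e / (1 + absc d))).
  by rewrite lt_min k0 divr_gt0.
move=> w; rewrite lt_min => /andP[wk we].
have /kP := wk; rewrite [z + _]addrC subrK => A.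
have -> : f w - f z = (f w - f z - d * (w - z)) + d * (w - z) by rewrite subrK.
rewrite (le_lt_trans (abscD _ _))//.
rewrite (@le_lt_trans _ _ ((1 + absc d) * absc (w - z)))//.
  by rewrite mulrDl abscM lerD2r.
by rewrite mulrC -ltr_pdivlMr.
Qed.

Lemma cderiv_comp f g z d d' :
  cderiv g z d -> cderiv f (g z) d' -> cderiv (f \o g) z (d' * d).
Proof.
move=> gd fd e e0.
have K0 : 0 < 1 + absc d by rewrite ltr_pwDl// absc_ge0.
have K1 : 0 < 1 + absc d' by rewrite ltr_pwDl// absc_ge0.
(* error budget: e/2 for each of the two first-order expansions *)
pose e1 := e / (2 * (1 + absc d)).
pose e2 := Num.min 1 (e / (2 * (1 + absc d'))).
have e10 : 0 < e1 by rewrite divr_gt0// mulr_gt0.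
have e20 : 0 < e2 by rewrite lt_min ltr01 divr_gt0// mulr_gt0.
have [k1 k10 k1P] := fd _ e10.
have [k2 k20 k2P] := gd _ e20.
exists (Num.min k2 (k1 / (1 + absc d))).
  by rewrite lt_min k20 divr_gt0.
move=> h; rewrite lt_min => /andP[hk2 hk1] /=.
set l := g (z + h) - g z.
have lE : absc (l - d * h) <= e2 * absc h by exact: k2P.
have lh : absc l <= (1 + absc d) * absc h.
  have -> : l = (l - d * h) + d * h by rewrite subrK.
  rewrite (le_trans (abscD _ _))// mulrDl abscM lerD2r.
  by rewrite (le_trans lE)// ler_wpM2r ?absc_ge0// ge_min lexx.
have lk : absc l < k1.
  by rewrite (le_lt_trans lh)// mulrC -ltr_pdivlMr.
have := k1P l lk; rewrite (_ : g z + l = g (z + h)); last first.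
  by rewrite addrC subrK.
move=> F.
have -> : f (g (z + h)) - f (g z) - d' * d * h =
  (f (g (z + h)) - f (g z) - d' * l) + d' * (l - d * h) by ring.
rewrite (le_trans (abscD _ _))//.
rewrite [e]splitr mulrDl lerD//.
  rewrite (le_trans F)// (le_trans (ler_wpM2l (ltW e10) lh))//.
  rewrite mulrA ler_wpM2r ?absc_ge0//.
  by rewrite /e1 invfM mulrA mulfVK ?gt_eqF.
rewrite abscM (le_trans (ler_wpM2l (absc_ge0 _) lE))//.
rewrite mulrA ler_wpM2r ?absc_ge0//.
rewrite (@le_trans _ _ ((1 + absc d') * e2))//.
  by rewrite ler_wpM2r ?(ltW e20)// lerDr.
rewrite mulrC -ler_pdivlMr// ge_min; apply/orP; right.
by rewrite invfM mulrA.
Qed.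

Lemma cderiv_affine a b z : cderiv (fun w => a * w + b) z a.
Proof.
move=> e e0; exists 1 => // h _.
have -> : a * (z + h) + b - (a * z + b) - a * h = 0 by ring.
by rewrite absc0 mulr_ge0 ?absc_ge0// ltW.
Qed.

End ComplexDerivative.

(** * Integrals over segments and continuity along curves *)

Section SegmentIntegral.
Context {R : realType}.
Local Notation leb := (@lebesgue_measure R).
Implicit Types (h : R -> R) (a b c : R).

Lemma seg_integrable h a b : {in `[a, b], continuous h} ->
  leb.-integrable `[a, b] (EFin \o h).
Proof.
move=> hc; apply: continuous_compact_integrable; first exact: segment_compact.
by apply: continuous_in_subspaceT => x /set_mem; exact: hc.
Qed.

Lemma seg_Rintegral_cst r a b : a <= b ->
  \int[leb]_(x in `[a, b]) r = r * (b - a).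
Proof.
move=> ab; rewrite Rintegral_cst//= lebesgue_measure_itv/= lte_fin.
case: ltP => //= ba; have -> : b = a by apply/eqP; rewrite eq_le ba.
by rewrite subrr mulr0.
Qed.

Lemma seg_Rintegral_cat h a c b : a <= c <= b -> {in `[a, b], continuous h} ->
  \int[leb]_(x in `[a, b]) h x =
  \int[leb]_(x in `[a, c]) h x + \int[leb]_(x in `[c, b]) h x.
Proof.
move=> /andP[ac cb] hc; apply/eqP; rewrite addrC -subr_eq; apply/eqP.
have hi := seg_integrable hc.
have /(_ (BLeft a) (BRight b) c) := @Rintegral_itvB R h.
rewrite !bnd_simp => ->//.
rewrite Rintegral_itv_obnd_cbnd//; apply: integrableS hi => //.
by apply: subset_itvr; rewrite bnd_simp.
Qed.

Lemma seg_Rintegral_bound h (k : R) a b (e : R) : a <= b -> {in `[a, b], continuous h} ->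
  (forall x, a <= x <= b -> `|h x - k| <= e) ->
  `|\int[leb]_(x in `[a, b]) h x - k * (b - a)| <= e * (b - a).
Proof.
move=> ab hc hk; have hi := seg_integrable hc.
have ci (r : R) : leb.-integrable `[a, b] (EFin \o (fun=> r)).
  by apply: seg_integrable => x _; exact: cst_continuous.
rewrite ler_norml -(seg_Rintegral_cst k ab) -mulNr -!(seg_Rintegral_cst _ ab).
rewrite lerBrDr lerBlDr -!RintegralD//.
apply/andP; split; apply: le_Rintegral => // x /=; rewrite in_itv/= => /hk;
  rewrite ler_norml => /andP[]; lra.
Qed.

Lemma continuous_eps h t :
  (forall e, 0 < e -> exists2 d, 0 < d &
     forall u, `|u - t| < d -> `|h u - h t| < e) -> {for t, continuous h}.
Proof.
move=> H; apply/cvgrPdist_lt => e /H[d d0 dP].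
near=> u; rewrite distrC; apply: dP; rewrite distrC; near: u.
by apply: (@cvgr_dist_lt _ _ _ (nbhs t) _ id t).
Unshelve. all: by end_near. Qed.

Lemma eps_continuous h t : {for t, continuous h} ->
  forall e, 0 < e -> exists2 d, 0 < d &
     forall u, `|u - t| < d -> `|h u - h t| < e.
Proof.
move=> /cvgrPdist_lt hc e /hc /nbhs_ballP[d /= d0 dP]; exists d => // u ut.
by rewrite distrC; apply: dP; rewrite /ball/= distrC.
Qed.

End SegmentIntegral.

Section Curves.
Context {R : realType}.
Local Notation C := (R[i]).

(** Continuity of a curve at a parameter, in the modulus; [ccont_pcont] and the
    lemmas on real and imaginary parts bring it back to real functions. *)
Definition pcont (c : R -> C) t := forall e, 0 < e -> exists2 d, 0 < d &
  forall u, `|u - t| < d -> absc (c u - c t) < e.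

Lemma ccont_pcont (f : C -> C) c t :
  ccont f (c t) -> pcont c t -> pcont (f \o c) t.
Proof.
move=> fc cc e /fc[d /cc[k k0 kP] dP]; exists k => // u /kP; exact: dP.
Qed.

Lemma pcont_Re c t : pcont c t -> {for t, continuous (fun u => Re (c u))}.
Proof.
move=> cc; apply: continuous_eps => e /cc[d d0 dP]; exists d => // u /dP.
by apply: le_lt_trans; rewrite (le_trans _ (absc_Re _))//; case: (c u) (c t) => ? ? [].
Qed.

Lemma pcont_Im c t : pcont c t -> {for t, continuous (fun u => Im (c u))}.
Proof.
move=> cc; apply: continuous_eps => e /cc[d d0 dP]; exists d => // u /dP.
by apply: le_lt_trans; rewrite (le_trans _ (absc_Im _))//; case: (c u) (c t) => ? ? [].
Qed.

Lemma pcont_absc c t : pcont c t -> {for t, continuous (fun u => absc (c u))}.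
Proof.
move=> cc; apply: continuous_eps => e /cc[d d0 dP]; exists d => // u /dP.
by apply: le_lt_trans; exact: le_norm_abscB.
Qed.

Lemma pcont_ReIm (x y : R -> R) t : {for t, continuous x} ->
  {for t, continuous y} -> pcont (fun u => x u +i* y u) t.
Proof.
move=> /eps_continuous xc /eps_continuous yc e e0.
have e20 : 0 < e / 2 by rewrite divr_gt0.
have [d1 d10 d1P] := xc _ e20; have [d2 d20 d2P] := yc _ e20.
exists (Num.min d1 d2); first by rewrite lt_min d10.
move=> u; rewrite lt_min => /andP[/d1P xu /d2P yu].
by rewrite (le_lt_trans (absc_le_ReIm _))//= [e]splitr ltrD.
Qed.

Lemma pcont_expi (p : C) (r t : R) :
  pcont (fun u => p + r%:C * expi u) t.
Proof.
have Ec : pcont (@expi R) t.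
  by apply: pcont_ReIm; [exact: continuous_cos|exact: continuous_sin].
move=> e e0.
have /Ec[d d0 dP] : 0 < e / (1 + `|r|) by rewrite divr_gt0.
exists d => // u /dP.
have -> : p + r%:C * expi u - (p + r%:C * expi t) = r%:C * (expi u - expi t).
  by ring.
rewrite abscM absc_real ltr_pdivlMr// => A; rewrite (le_lt_trans _ A)//.
by rewrite mulrC ler_wpM2l ?absc_ge0// lerDr.
Qed.

Lemma pcont_hline (y t : R) : pcont (fun u => u +i* y) t.
Proof. by apply: pcont_ReIm; [exact: cvg_id|exact: cvg_cst]. Qed.

Lemma pcont_vline (x t : R) : pcont (fun u => x +i* u) t.
Proof. by apply: pcont_ReIm; [exact: cvg_cst|exact: cvg_id]. Qed.

End Curves.

(** * Goursat's theorem for rectangles *)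

Section Goursat.
Context {R : realType}.
Local Notation C := (R[i]).
Local Notation leb := (@lebesgue_measure R).
Variable G : C -> C.

(** The imaginary part of the contour integral of G along the boundary of the
    rectangle.  It determines the real part as well, through - i * G, and is
    all that the mean value property of Re G uses. *)
Definition boundary (a b c d : R) : R :=
  \int[leb]_(y in `[c, d]) (Re (G (b +i* y)) - Re (G (a +i* y))) +
  \int[leb]_(x in `[a, b]) (Im (G (x +i* c)) - Im (G (x +i* d))).

Definition cderiv_rect a b c d := forall x y : R,
  a <= x <= b -> c <= y <= d -> exists D, cderiv G (x +i* y) D.

Lemma sub_cderiv_rect a b c d a' b' c' d' :
  a <= a' -> b' <= b -> c <= c' -> d' <= d ->
  cderiv_rect a b c d -> cderiv_rect a' b' c' d'.
Proof.
move=> aa bb cc dd H x y /andP[ax xb] /andP[cy yd].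
by apply: H; apply/andP; split; lra.
Qed.

Lemma cderiv_rect_vline a b c d x : cderiv_rect a b c d -> a <= x <= b ->
  {in `[c, d], continuous (fun y : R => Re (G (x +i* y)))}.
Proof.
move=> H xab y; rewrite in_itv/= => yd; have [D HD] := H _ _ xab yd.
by apply: pcont_Re; apply: ccont_pcont (pcont_vline _ _); exact: cderiv_ccont HD.
Qed.

Lemma cderiv_rect_hline a b c d y : cderiv_rect a b c d -> c <= y <= d ->
  {in `[a, b], continuous (fun x : R => Im (G (x +i* y)))}.
Proof.
move=> H ycd x; rewrite in_itv/= => xd; have [D HD] := H _ _ xd ycd.
by apply: pcont_Im; apply: ccont_pcont (pcont_hline _ _); exact: cderiv_ccont HD.
Qed.

Lemma continuous_inB (h k : R -> R) a b : {in `[a, b], continuous h} ->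
  {in `[a, b], continuous k} -> {in `[a, b], continuous (h \- k)}.
Proof. by move=> hc kc x xab; apply: cvgB; [exact: hc|exact: kc]. Qed.

Lemma boundary_hsplit a m b c d : a <= m <= b -> c <= d ->
  cderiv_rect a b c d ->
  boundary a b c d = boundary a m c d + boundary m b c d.
Proof.
move=> amb cd H; have [am mb] := andP amb; have ab := le_trans am mb.
have V x : a <= x <= b -> leb.-integrable `[c, d] (EFin \o (fun y => Re (G (x +i* y)))).
  by move=> ?; apply/seg_integrable/(cderiv_rect_vline H).
have Hl y : c <= y <= d -> {in `[a, b], continuous (fun x : R => Im (G (x +i* y)))}.
  exact: (cderiv_rect_hline H).
rewrite /boundary (seg_Rintegral_cat amb); last first.
  by apply: continuous_inB; apply: Hl; rewrite lexx ?cd.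
rewrite !RintegralB//; try by apply: V; rewrite ?lexx ?am ?mb ?ab.
all: try by apply/seg_integrable => x; rewrite in_itv/= => /andP[? ?];
  apply: Hl; rewrite ?lexx ?cd// in_itv/=; apply/andP; split; lra.
by ring.
Qed.

Lemma boundary_vsplit a b c n d : a <= b -> c <= n <= d ->
  cderiv_rect a b c d ->
  boundary a b c d = boundary a b c n + boundary a b n d.
Proof.
move=> ab cnd H; have [cn nd] := andP cnd; have cd := le_trans cn nd.
have V x : a <= x <= b -> {in `[c, d], continuous (fun y : R => Re (G (x +i* y)))}.
  exact: (cderiv_rect_vline H).
have Hl y : c <= y <= d -> leb.-integrable `[a, b] (EFin \o (fun x => Im (G (x +i* y)))).
  by move=> ?; apply/seg_integrable/(cderiv_rect_hline H).
rewrite /boundary (seg_Rintegral_cat cnd); last first.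
  by apply: continuous_inB; apply: V; rewrite lexx ?ab.
rewrite !RintegralB//; try by apply: Hl; rewrite ?lexx ?cn ?nd ?cd.
all: try by apply/seg_integrable => x; rewrite in_itv/= => /andP[? ?];
  apply: V; rewrite ?lexx ?ab// in_itv/=; apply/andP; split; lra.
by ring.
Qed.

(** The affine part of G contributes nothing to the boundary sum: by
   Cauchy-Riemann its two integrals cancel. *)
Lemma boundary_near (p D : C) e a b c d : a <= b -> c <= d ->
  cderiv_rect a b c d ->
  (forall x y, a <= x <= b -> c <= y <= d ->
    absc (G (x +i* y) - G p - D * (x +i* y - p)) <= e) ->
  `|boundary a b c d| <= 2 * e * (b - a + (d - c)).
Proof.
move=> ab cd H E.
have V : `|\int[leb]_(y in `[c, d]) (Re (G (b +i* y)) - Re (G (a +i* y)))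
    - Re D * (b - a) * (d - c)| <= 2 * e * (d - c).
  apply: seg_Rintegral_bound => //.
    by apply: continuous_inB; apply: (cderiv_rect_vline H); rewrite ?lexx ?ab.
  move=> y ycd.
  have := le_trans (absc_Re _) (E b y _ ycd); rewrite ab lexx => /(_ isT).
  have := le_trans (absc_Re _) (E a y _ ycd); rewrite ab lexx => /(_ isT).
  move: (G _) (G _) (G _) => [? ?] [? ?] [? ?]; case: (p) (D) => [? ?] [? ?] /=.
  rewrite !ler_norml => /andP[? ?] /andP[? ?]; apply/andP; split; lra.
have Hl : `|\int[leb]_(x in `[a, b]) (Im (G (x +i* c)) - Im (G (x +i* d)))
    - Re D * (c - d) * (b - a)| <= 2 * e * (b - a).
  apply: seg_Rintegral_bound => //.
    by apply: continuous_inB; apply: (cderiv_rect_hline H); rewrite ?lexx ?cd.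
  move=> x xab.
  have := le_trans (absc_Im _) (E x c xab _); rewrite cd lexx => /(_ isT).
  have := le_trans (absc_Im _) (E x d xab _); rewrite cd lexx => /(_ isT).
  move: (G _) (G _) (G _) => [? ?] [? ?] [? ?]; case: (p) (D) => [? ?] [? ?] /=.
  rewrite !ler_norml => /andP[? ?] /andP[? ?]; apply/andP; split; lra.
rewrite /boundary; move: V Hl.
set I := Rintegral _ _ _; set J := Rintegral _ _ _.
rewrite !ler_norml => /andP[? ?] /andP[? ?]; apply/andP; split; lra.
Qed.

Section Bisection.
Variables (a0 c0 w h e : R).
Hypotheses (w0 : 0 <= w) (h0 : 0 <= h) (e0 : 0 < e).
Hypothesis HG : cderiv_rect a0 (a0 + w) c0 (c0 + h).

Let W n := w / 2 ^+ n.
Let H n := h / 2 ^+ n.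

Let halfE x n : x / 2 ^+ n = x / 2 ^+ n.+1 + x / 2 ^+ n.+1 :> R.
Proof. by rewrite exprS invfM mulrCA [2^-1 * _]mulrC -splitr. Qed.

(** A rectangle of the n-th generation, inside the original one, whose boundary
    integral is too large for its size. *)
Definition bad n (q : R * R) := [/\ a0 <= q.1, q.1 + W n <= a0 + w,
  c0 <= q.2, q.2 + H n <= c0 + h &
  e * (W n + H n) ^+ 2 < `|boundary q.1 (q.1 + W n) q.2 (q.2 + H n)|].

Let bad_half n q : bad n q -> exists q' : R * R,
  [/\ q.1 <= q'.1, q'.1 + W n.+1 <= q.1 + W n,
      q.2 <= q'.2, q'.2 + H n.+1 <= q.2 + H n & bad n.+1 q'].
Proof.
case: q => a c [/= aa aw cc ch B].
set W' := W n.+1; set H' := H n.+1.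
have WE : W n = W' + W' := halfE w n.
have HE : H n = H' + H' := halfE h n.
have W0 : 0 <= W' by rewrite divr_ge0// exprn_ge0.
have H0 : 0 <= H' by rewrite divr_ge0// exprn_ge0.
have D x y z t : a <= x -> y <= a + W n -> c <= z -> t <= c + H n ->
    cderiv_rect x y z t.
  by move=> ? ? ? ?; apply: sub_cderiv_rect HG; lra.
have BE : boundary a (a + W n) c (c + H n) =
  boundary a (a + W') c (c + H') + boundary a (a + W') (c + H') (c + H n) +
  (boundary (a + W') (a + W n) c (c + H') +
   boundary (a + W') (a + W n) (c + H') (c + H n)).
  rewrite (@boundary_hsplit _ (a + W')); [|lra|lra|apply: D; lra].
  rewrite (@boundary_vsplit a (a + W') c (c + H')); [|lra|lra|apply: D; lra].
  by rewrite (@boundary_vsplit (a + W') (a + W n) c (c + H'));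
    [|lra|lra|apply: D; lra].
have : exists2 q' : R * R, (q'.1 = a \/ q'.1 = a + W') /\ (q'.2 = c \/ q'.2 = c + H') &
    e * (W' + H') ^+ 2 < `|boundary q'.1 (q'.1 + W') q'.2 (q'.2 + H')|.
  apply/not_exists2P => N.
  have Q x y : x = a \/ x = a + W' -> y = c \/ y = c + H' ->
      `|boundary x (x + W') y (y + H')| <= e * (W' + H') ^+ 2.
    by move=> ? ?; rewrite leNgt; apply/negP => ?; have [] := N (x, y); tauto.
  have aE : a + W' + W' = a + W n by rewrite WE addrA.
  have cE : c + H' + H' = c + H n by rewrite HE addrA.
  have := Q a c; have := Q a (c + H'); have := Q (a + W') c.
  have := Q (a + W') (c + H'); rewrite !aE !cE.
  move=> /(_ (or_intror erefl) (or_intror erefl)) Q1.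
  move=> /(_ (or_intror erefl) (or_introl erefl)) Q2.
  move=> /(_ (or_introl erefl) (or_intror erefl)) Q3.
  move=> /(_ (or_introl erefl) (or_introl erefl)) Q4.
  move: B; rewrite BE ltNge => /negP; apply.
  have -> : e * (W n + H n) ^+ 2 = (e * (W' + H') ^+ 2) *+ 4.
    by rewrite WE HE; ring.
  rewrite (le_trans (ler_normD _ _))//.
  have := ler_normD (boundary a (a + W') c (c + H'))
    (boundary a (a + W') (c + H') (c + H n)).
  have := ler_normD (boundary (a + W') (a + W n) c (c + H'))
    (boundary (a + W') (a + W n) (c + H') (c + H n)).
  lra.
case=> -[x y] /= [xE yE] B'; exists (x, y); move: B'.
have BQ x' y' : a <= x' -> x' + W' <= a + W n -> c <= y' ->
    y' + H' <= c + H n -> e * (W' + H') ^+ 2 <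
      `|boundary x' (x' + W') y' (y' + H')| ->
    [/\ a <= x', x' + W' <= a + W n, c <= y', y' + H' <= c + H n
      & bad n.+1 (x', y')].
  by move=> ? ? ? ? ?; split => //; split => //=; rewrite -/W' -/H'; lra.
by case: xE => ->; case: yE => -> /BQ; apply; lra.
Qed.

(** One of the four quarters of a bad rectangle is bad, since its boundary
    integral is the sum of theirs while the bound is divided by 4.  The nested
    bad rectangles shrink to a point, where the first-order expansion of G
    contradicts badness. *)
Lemma boundary_not_bad q : ~ bad 0 q.
Proof.
move=> B0.
have /choice[F FP] : forall nq : nat * (R * R), exists q' : R * R,
    bad nq.1 nq.2 ->
    [/\ nq.2.1 <= q'.1, q'.1 + W nq.1.+1 <= nq.2.1 + W nq.1,
      nq.2.2 <= q'.2, q'.2 + H nq.1.+1 <= nq.2.2 + H nq.1 & bad nq.1.+1 q'].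
  move=> [n q'] /=; have [/bad_half[q'' ?]|?] := pselect (bad n q').
    by exists q''.
  by exists q'.
pose u := fix u n := if n is m.+1 then F (m, u m) else q.
have uB n : bad n (u n) by elim: n => //= n IH; have [] := FP (n, u n) IH.
have uS n : [/\ (u n).1 <= (u n.+1).1, (u n.+1).1 + W n.+1 <= (u n).1 + W n,
    (u n).2 <= (u n.+1).2 & (u n.+1).2 + H n.+1 <= (u n).2 + H n].
  by have [] := FP (n, u n) (uB n).
have W0 n : 0 <= W n by rewrite divr_ge0// exprn_ge0.
have H0 n : 0 <= H n by rewrite divr_ge0// exprn_ge0.
have uD n k : [/\ (u n).1 <= (u (k + n)%N).1,
    (u (k + n)%N).1 + W (k + n) <= (u n).1 + W n,
    (u n).2 <= (u (k + n)%N).2 & (u (k + n)%N).2 + H (k + n) <= (u n).2 + H n].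
  elim: k => [|k [? ? ? ?]]; first by split.
  by have [? ? ? ?] := uS (k + n)%N; split; rewrite addSn; lra.
pose x := sup (range (fun n => (u n).1)).
pose y := sup (range (fun n => (u n).2)).
have xP n : (u n).1 <= x <= (u n).1 + W n.
  have U m : (u m).1 <= (u n).1 + W n.
    have := W0 m; have := W0 n; have [mn|/ltnW mn] := leqP m n.
      by have [] := uD m (n - m)%N; rewrite subnK//; lra.
    by have [] := uD n (m - n)%N; rewrite subnK//; lra.
  apply/andP; split; last first.
    by apply: ge_sup => [|_ [m _ <-]]; [exists (u 0%N).1; exists 0%N|exact: U].
  apply: ub_le_sup; last by exists n.
  by exists ((u n).1 + W n) => _ [m _ <-]; exact: U.
have yP n : (u n).2 <= y <= (u n).2 + H n.
  have U m : (u m).2 <= (u n).2 + H n.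
    have := H0 m; have := H0 n; have [mn|/ltnW mn] := leqP m n.
      by have [] := uD m (n - m)%N; rewrite subnK//; lra.
    by have [] := uD n (m - n)%N; rewrite subnK//; lra.
  apply/andP; split; last first.
    by apply: ge_sup => [|_ [m _ <-]]; [exists (u 0%N).2; exists 0%N|exact: U].
  apply: ub_le_sup; last by exists n.
  by exists ((u n).2 + H n) => _ [m _ <-]; exact: U.
have [D HD] : exists D, cderiv G (x +i* y) D.
  have [? ? ? ? _] := uB 0%N; have := xP 0%N; have := yP 0%N.
  by move=> /andP[? ?] /andP[? ?]; apply: HG; apply/andP; split; lra.
have e20 : 0 < e / 2 by rewrite divr_gt0.
have [k k0 kP] := HD _ e20.
(* a rectangle small enough for the first-order expansion at the limit point *)
have [n nk] : exists n, W n + H n < k.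
  exists (Num.truncn ((w + h) / k)).+1; rewrite /W /H -mulrDl.
  rewrite ltr_pdivrMr ?exprn_gt0// mulrC -ltr_pdivrMr//.
  rewrite (lt_trans (truncnS_gt _))// -natrX ltr_nat.
  exact: ltn_expl.
have [B1 B2 B3 B4] := uB n; rewrite ltNge => /negP; apply.
have := xP n; have := yP n; have := W0 n; have := H0 n.
move: B1 B2 B3 B4 nk.
set a := (u n).1; set c := (u n).2; set w' := W n; set h' := H n.
move=> ? ? ? ? nk h'0 w'0 /andP[? ?] /andP[? ?].
have -> : e * (w' + h') ^+ 2 =
    2 * (e / 2 * (w' + h')) * (a + w' - a + (c + h' - c)) by field.
apply: (@boundary_near (x +i* y) D); [lra|lra| |].
  by apply: sub_cderiv_rect HG; lra.
move=> x' y' /andP[? ?] /andP[? ?].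
have A : absc (x' +i* y' - (x +i* y)) <= w' + h'.
  rewrite (le_trans (absc_le_ReIm _))//=.
  by apply: lerD; rewrite ler_norml; apply/andP; split; lra.
have := kP _ (le_lt_trans A nk); rewrite [_ +i* _ + _]addrC subrK => /le_trans; apply.
by rewrite ler_wpM2l// ltW.
Qed.

End Bisection.

(** The bisection gives a bound of the boundary integral by every positive
    multiple of the squared half-perimeter. *)
Lemma Goursat a b c d : a <= b -> c <= d -> cderiv_rect a b c d ->
  boundary a b c d = 0.
Proof.
move=> ab cd HG; apply/eqP; rewrite -normr_le0; apply/ler_addgt0Pl => e e0.
rewrite addr0 leNgt; apply/negP => B.
(* adding 1 keeps K positive for a degenerate rectangle *)
pose K := (b - a + (d - c)) ^+ 2 + 1.
have K0 : 0 < K by rewrite ltr_wpDl ?sqr_ge0.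
have bE x y : x + (y - x) = y :> R by ring.
apply: (@boundary_not_bad a c (b - a) (d - c) (e / K) _ _ _ _ (a, c));
  rewrite ?subr_ge0 ?divr_gt0//.
  by rewrite !bE.
rewrite /bad /= !expr0 !divr1 !bE; split => //.
rewrite (le_lt_trans _ B)// -mulrA ler_piMr ?(ltW e0)//.
by rewrite mulrC ler_pdivrMr// mul1r lerDl.
Qed.

End Goursat.

(** * The mean value property *)

Section MeanValue.
Context {R : realType}.
Local Notation C := (R[i]).
Local Notation leb := (@lebesgue_measure R).

Lemma is_derive_expand (f : R -> R) (d : R) : is_derive (0 : R) 1 f d ->
  forall e, 0 < e -> exists2 k, (0 : R) < k &
    forall a, `|a| < k -> `|f a - f 0 - d * a| <= e * `|a|.
Proof.
move=> [/cvg_ex[l fl] fd] e e0; have {fd} ld : l = d.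
  by rewrite -fd; apply/esym/cvg_lim.
move/cvgrPdist_le : fl => /(_ _ e0) /nbhs_ballP[k /= k0 kP].
exists k => // a ak; have [->|a0] := eqVneq a 0.
  by rewrite mulr0 subr0 subrr normr0 mulr0.
have := kP a; rewrite /ball/= sub0r normrN => /(_ ak a0).
rewrite ld /GRing.scale/= mulr1 addr0 => A.
rewrite -normrN -ler_pdivrMr ?normr_gt0// -normfV -normrM.
suff -> : - (f a - f 0 - d * a) / a = d - a^-1 * (f a - f 0) by [].
by field.
Qed.

Definition cexp (w : C) : C := (expR (Re w))%:C * expi (Im w).

Lemma cexpD w v : cexp (w + v) = cexp w * cexp v.
Proof.
case: w v => [a b] [c d]; rewrite /cexp /= expRD expiD rmorphM.
by rewrite mulrACA.
Qed.

Lemma cexp0 : cexp 0 = 1.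
Proof. by rewrite /cexp /= expR0 expi0 mulr1. Qed.

Lemma absc_cexp w : absc (cexp w) = expR (Re w).
Proof. by rewrite abscM absc_expi mulr1 absc_real ger0_norm// expR_ge0. Qed.

(** At 0 the expansion of exp, cos and sin along the real axis suffices: writing
    exp a * cos b - 1 - a and exp a * sin b - b as sums of products, every term
    is a first-order remainder times a bounded factor or a product of two
    infinitesimals. *)
Lemma cderiv_cexp0 : cderiv cexp 0 1.
Proof.
move=> e e0.
(* the four error terms below add up to 8 * e1 times the modulus *)
pose e1 := Num.min 1 (e / 8).
have e10 : 0 < e1 by rewrite lt_min ltr01 divr_gt0.
have e11 : e1 <= 1 by rewrite ge_min lexx.
have e18 : 8 * e1 <= e by rewrite mulrC -ler_pdivlMr// ge_min lexx orbT.
have [k1 k10 E] := is_derive_expand (is_derive_expR (0 : R)) e10.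
have [k2 k20 Cs] := is_derive_expand (is_derive_cos (0 : R)) e10.
have [k3 k30 S] := is_derive_expand (is_derive_sin (0 : R)) e10.
exists (Num.min (Num.min k1 k2) (Num.min k3 e1)).
  by rewrite !lt_min k10 k20 k30 ltr01 divr_gt0.
move=> h; rewrite !lt_min => /andP[/andP[h1 h2] /andP[h3 h4]].
rewrite -lt_min -/e1 in h4.
have a1 := absc_Re h; have b1 := absc_Im h.
rewrite add0r cexp0 mul1r.
have := E _ (le_lt_trans a1 h1); have := Cs _ (le_lt_trans b1 h2).
have := S _ (le_lt_trans b1 h3).
rewrite expR0 sin0 oppr0 cos0 mul0r !mul1r !subr0 ?addr0 => {E Cs S} S Cs E.
rewrite (le_trans (absc_le_ReIm _))//.
move: a1 b1 h4 S Cs E; rewrite /cexp /expi.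
move: (absc_ge0 h) e18; set r := absc h; clearbody r.
case: h {h1 h2 h3} => a b /= r0 e18 a1 b1 h4 S Cs E.
rewrite !mul0r subr0 addr0.
have -> : expR a * cos b - 1 - a =
  (expR a - 1 - a) * cos b + (1 + a) * (cos b - 1) by ring.
have -> : expR a * sin b - 0 - b = (expR a - 1) * sin b + (sin b - b) by ring.
have c1 : `|cos b| <= 1 by rewrite ler_norml cos_geN1 cos_le1.
have A1 : `|(expR a - 1 - a) * cos b| <= e1 * r.
  rewrite normrM -[e1 * r]mulr1 ler_pM// (le_trans E)// ler_wpM2l// ltW//.
have A2 : `|(1 + a) * (cos b - 1)| <= 2 * (e1 * r).
  rewrite normrM ler_pM//.
    by rewrite (le_trans (ler_normD _ _))// normr1; lra.
  by rewrite (le_trans Cs)// ler_wpM2l// ltW.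
have A3 : `|sin b - b| <= e1 * r by rewrite (le_trans S)// ler_wpM2l// ltW.
have ea : `|expR a - 1| <= 2 * r.
  have -> : expR a - 1 = expR a - 1 - a + a by rewrite subrK.
  rewrite (le_trans (ler_normD _ _))//.
  have : e1 * `|a| <= 1 * `|a| by rewrite ler_wpM2r.
  lra.
have sb : `|sin b| <= 2 * e1.
  have -> : sin b = sin b - b + b by rewrite subrK.
  rewrite (le_trans (ler_normD _ _))//.
  have : e1 * `|b| <= 1 * `|b| by rewrite ler_wpM2r.
  lra.
have A4 : `|(expR a - 1) * sin b| <= 4 * (e1 * r).
  rewrite normrM (_ : 4 * (e1 * r) = 2 * r * (2 * e1)); last by ring.
  exact: ler_pM.
have := ler_normD ((expR a - 1 - a) * cos b) ((1 + a) * (cos b - 1)).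
have := ler_normD ((expR a - 1) * sin b) (sin b - b).
have : 8 * e1 * r <= e * r by rewrite ler_wpM2r.
have : e1 * r >= 0 by rewrite mulr_ge0// ltW.
lra.
Qed.

Lemma cderiv_cexp w : cderiv cexp w (cexp w).
Proof.
move=> e e0; have c0 : 0 < absc (cexp w) by rewrite absc_cexp expR_gt0.
have [k k0 kP] := cderiv_cexp0 (divr_gt0 e0 c0).
exists k => // h /kP; rewrite add0r cexp0 mul1r cexpD.
have -> : cexp w * cexp h - cexp w - cexp w * h = cexp w * (cexp h - 1 - h).
  by ring.
by rewrite abscM mulrAC ler_pdivlMr// mulrC.
Qed.

(** In the coordinate w with z = p + exp w the circles around p become
    segments of length 2 pi on which z is periodic, so the horizontal sides of
    a rectangle of that height cancel and the vertical ones have equal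
    integrals.  Moving one of them to the left shrinks its circle to p. *)
Lemma mean_value_Re (g : C -> C) p (r0 r : R) : 0 < r < r0 ->
  (forall z, absc (z - p) < r0 -> exists d, cderiv g z d) ->
  \int[leb]_(t in `[0, 2 * pi]) Re (g (p + r%:C * expi t)) = Re (g p) * (2 * pi).
Proof.
move=> /andP[r_gt0 rr0] gd.
have pi2 : 0 <= 2 * pi :> R by rewrite mulr_ge0// pi_ge0.
pose G w := g (p + cexp w).
have dG a : a <= ln r -> cderiv_rect G a (ln r) 0 (2 * pi).
  move=> ar x y /andP[ax xr] _.
  have [d gD] : exists d, cderiv g (p + cexp (x +i* y)) d.
    apply: gd; rewrite [p + _]addrC addrK absc_cexp /=.
    by rewrite (le_lt_trans _ rr0)// -ler_ln ?posrE ?expR_gt0// expRK.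
  exists (d * (1 * cexp (x +i* y))).
  apply: (@cderiv_comp _ _ (fun w => p + cexp w)) gD.
  apply: (@cderiv_comp _ (fun w => p + w) cexp); first exact: cderiv_cexp.
  have -> : (fun w => p + w) = (fun w : C => 1 * w + p).
    by apply/funext => w; rewrite mul1r addrC.
  exact: cderiv_affine.
have Gper x : G (x +i* (2 * pi)) = G (x +i* 0).
  by rewrite /G /cexp /= -[2 * pi]add0r expi_per.
have key a : a <= ln r ->
    \int[leb]_(t in `[0, 2 * pi]) Re (g (p + r%:C * expi t)) =
    \int[leb]_(t in `[0, 2 * pi]) Re (G (a +i* t)).
  move=> ar; have := Goursat ar pi2 (dG a ar); rewrite /boundary.
  have -> : \int[leb]_(x in `[a, ln r])
      (Im (G (x +i* 0)) - Im (G (x +i* (2 * pi)))) = 0.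
    under eq_Rintegral do rewrite Gper subrr.
    by rewrite seg_Rintegral_cst// mul0r.
  rewrite addr0 RintegralB//; last 2 first.
  - by apply/seg_integrable/(cderiv_rect_vline (dG a ar)); rewrite lexx ar.
  - by apply/seg_integrable/(cderiv_rect_vline (dG a ar)); rewrite lexx ar.
  move/eqP; rewrite subr_eq0 => /eqP <-.
  by apply: eq_Rintegral => t _; rewrite /G /cexp /= lnK.
(* the left side is now moved to a circle on which g is within e / (2 pi) of g p *)
apply/eqP; rewrite -subr_eq0 -normr_le0; apply/ler_addgt0Pl => e e0; rewrite addr0.
have pi2' : 0 < 2 * pi :> R by rewrite mulr_gt0// pi_gt0.
have [d0 pd] : exists d, cderiv g p d.
  by apply: gd; rewrite subrr absc0 (lt_trans r_gt0).
have [k k0 kP] := cderiv_ccont pd (divr_gt0 e0 pi2').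
pose a := Num.min (ln r) (ln (k / 2)).
have ar : a <= ln r by rewrite ge_min lexx.
rewrite (key a ar).
have := @seg_Rintegral_bound R (fun t => Re (G (a +i* t))) (Re (g p)) 0 (2 * pi)
  (e / (2 * pi)) pi2.
rewrite subr0 divfK ?gt_eqF//; apply.
  by apply: (cderiv_rect_vline (dG a ar)); rewrite lexx ar.
move=> t _; apply/ltW; have : absc (G (a +i* t) - g p) < e / (2 * pi).
  apply: kP; rewrite [p + _]addrC addrK absc_cexp /=.
  rewrite (@le_lt_trans _ _ (k / 2))//; last first.
    by rewrite ltr_pdivrMr// mulr_natr mulr2n ltrDl.
  rewrite -ler_ln ?posrE ?expR_gt0 ?divr_gt0// expRK.
  by rewrite ge_min lexx orbT.
apply: le_lt_trans; rewrite (le_trans _ (absc_Re _))//.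
by case: (G _) (g p) => ? ? [].
Qed.

End MeanValue.

(** * Sub-mean value property of powers of the modulus *)

Section SubMeanPower.
Context {R : realType}.
Local Notation C := (R[i]).
Local Notation leb := (@lebesgue_measure R).

Lemma Re_sqrtc_ge0 (w : C) : 0 <= Re (sqrtc w).
Proof. by case: w => a b; exact: sqrtr_ge0. Qed.

Lemma Re_sqrtc_gt0 (w : C) : 0 < Re w -> 0 < Re (sqrtc w).
Proof.
move=> w0; rewrite lt_neqAle Re_sqrtc_ge0 andbT eq_sym; apply/eqP => r0.
move: w0; rewrite -(sqr_sqrtc w) ltNge => /negP; apply.
move: r0; case: (sqrtc w) => a b /= ->.
by rewrite mul0r add0r oppr_le0 -expr2 sqr_ge0.
Qed.

(** Difference quotients are rationalised by (sqrt v - sqrt w) (sqrt v + sqrt w)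
   = v - w, and the second factor has modulus at least Re (sqrt w). *)
Lemma cderiv_sqrtc (w : C) : 0 < Re w -> exists d, cderiv (@sqrtc R) w d.
Proof.
move=> w0; pose a := Re (sqrtc w); have a0 : 0 < a by exact: Re_sqrtc_gt0.
have la (z : C) : a <= Re z -> a <= absc z.
  by move=> az; rewrite (le_trans az)// (le_trans (ler_norm _))// absc_Re.
exists (2 * sqrtc w)^-1 => e e0.
exists (Num.min (Re w) (e * a ^+ 3)).
  by rewrite lt_min w0 mulr_gt0// exprn_gt0.
move=> h; rewrite lt_min => /andP[hw he].
have wh0 : 0 < Re (w + h).
  case: (w) (h) hw => [u v] [x y] /= hw; have := absc_Re (x +i* y) => /=.
  by rewrite ler_norml => /andP[]; lra.
pose S := sqrtc (w + h) + sqrtc w.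
have aS : a <= absc S.
  apply: la; rewrite /a /S; have := Re_sqrtc_gt0 wh0.
  by case: (sqrtc _) (sqrtc _) => ? ? [? ?] /=; lra.
have aw : a <= absc (2 * sqrtc w).
  by apply: la; move: a0; rewrite /a mulr_natl mulr2n; case: (sqrtc w) => ? ? /=; lra.
have S0 : S != 0 by rewrite -absc_gt0 (lt_le_trans a0).
have w20 : 2 * sqrtc w != 0 by rewrite -absc_gt0 (lt_le_trans a0).
have dE : sqrtc (w + h) - sqrtc w = h / S.
  apply/(mulIf S0); rewrite divfK// -subr_sqr !sqr_sqrtc.
  by rewrite addrC addKr.
have r0 : sqrtc w != 0 by apply: contra_neq w20 => ->; rewrite mulr0.
have hE : h = (S - 2 * sqrtc w) * S.
  by rewrite -[LHS](divfK S0) -dE /S; ring.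
have -> : sqrtc (w + h) - sqrtc w - (2 * sqrtc w)^-1 * h =
    - (h * h) / (2 * sqrtc w * S * S).
  by rewrite dE hE; field; rewrite S0.
have K : absc h <= e * (absc (2 * sqrtc w) * absc S * absc S).
  rewrite (le_trans (ltW he))// ler_wpM2l ?(ltW e0)// !exprS expr0 mulr1 mulrA.
  by rewrite !ler_pM// ?mulr_ge0// ltW.
rewrite -!abscM in K; rewrite abscM abscN abscV [absc (h * h)]abscM.
rewrite ler_pdivrMr ?absc_gt0 ?mulf_neq0//.
by rewrite mulrAC ler_wpM2r ?absc_ge0.
Qed.

(** Young's inequality x * 1 <= x ^ q / q + 1 / q' for the conjugate exponent
    q', multiplied by q. *)
Lemma Bernoulli_powR (x q : R) : 0 <= x -> 1 < q -> 1 + q * (x - 1) <= x `^ q.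
Proof.
move=> x0 q1; have q0 : 0 < q by rewrite (lt_trans _ q1).
have p0 : 0 < 1 - q^-1 by rewrite subr_gt0 invf_lt1.
have := @conjugate_powR R x 1 q (1 - q^-1)^-1 x0 ler01 q0.
rewrite invr_gt0 p0 invrK => /(_ isT); rewrite addrC subrK => /(_ erefl).
rewrite powR1 mulr1 mul1r -(@ler_pM2l _ q)// mulrDr mulrC [q * (_ / q)]mulrC divfK ?gt_eqF//.
rewrite mulrBr mulr1 divff ?gt_eqF//; lra.
Qed.

Section Branch.
Variables (p : C) (r0 : R).

(** What iterated square roots need and preserve. *)
Definition root_data (k : C -> C) := k p = 1 /\ forall z, absc (z - p) < r0 ->
  0 < Re (k z) /\ exists d, cderiv k z d.

(** On the right half-plane the principal square root is holomorphic and stays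
    in the right half-plane, so it can be iterated. *)
Lemma root_branch k n : root_data k -> exists2 h, root_data h &
  forall z, absc (z - p) < r0 -> h z ^+ (2 ^ n) = k z.
Proof.
elim: n k => [|n IH] k kD; first by exists k.
have [h [hp hD] hk] := IH k kD.
exists (@sqrtc R \o h); last first.
  by move=> z zp; rewrite expnS exprM /= sqr_sqrtc hk.
split=> [|z /hD[hz [d hd]]]; first by rewrite /= hp sqrtc1.
split; first exact: Re_sqrtc_gt0.
have [d' hd'] := cderiv_sqrtc hz.
by exists (d' * d); apply: cderiv_comp hd hd'.
Qed.

End Branch.

Lemma circle_ball (p : C) (r r0 t : R) : 0 < r < r0 ->
  absc (p + r%:C * expi t - p) < r0.
Proof.
move=> /andP[r_gt0 rr0].
by rewrite addrC addKr abscM absc_expi mulr1 absc_real gtr0_norm.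
Qed.

Lemma powR_continuous (s x : R) : 0 < x -> {for x, continuous (@powR R ^~ s)}.
Proof.
move=> x0; apply/differentiable_continuous/derivable1_diffP.
by apply: derivable_powR; rewrite in_itv/= x0.
Qed.

(** Bernoulli's inequality for |h|, with h an iterated root of k, bounds |k| ^ s
    from below by an affine function of Re h, whose mean is its value at p. *)
Lemma submean_root_data (k : C -> C) (p : C) (r0 r s : R) :
  0 < r < r0 -> 0 < s -> root_data p r0 k ->
  2 * pi <= \int[leb]_(t in `[0, 2 * pi]) (absc (k (p + r%:C * expi t)) `^ s).
Proof.
move=> rr0 s0 kD; have pi2 : 0 <= 2 * pi :> R by rewrite mulr_ge0// pi_ge0.
(* the exponent q = s * 2 ^ n of |h| in |k| ^ s has to exceed 1 *)
have [n sn] : exists n, 1 < s * 2 ^+ n.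
  exists (Num.truncn s^-1).+1; rewrite mulrC -ltr_pdivrMr// mul1r.
  rewrite (lt_trans (truncnS_gt _))// -natrX ltr_nat.
  exact: ltn_expl.
have [h [hp hD] hk] := root_branch n kD.
have cb t := circle_ball p t rr0.
have cont (f : C -> C) : (forall z, absc (z - p) < r0 -> exists d, cderiv f z d) ->
    forall t, pcont (fun u => f (p + r%:C * expi u)) t.
  move=> fD t; have [d fd] := fD _ (cb t).
  by apply: (@ccont_pcont _ f); [exact: cderiv_ccont fd|exact: pcont_expi].
have hc := cont h (fun z zp => (hD z zp).2).
have kc := cont k (fun z zp => (kD.2 z zp).2).
have I1 : leb.-integrable `[0, 2 * pi]
    (EFin \o (fun t => absc (k (p + r%:C * expi t)) `^ s)).
  apply: seg_integrable => t _.
  apply: (@continuous_comp _ _ _ (fun t => absc (k (p + r%:C * expi t))) (@powR R ^~ s)).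
    by have := pcont_absc (kc t).
  apply: powR_continuous; rewrite absc_gt0; have [] := kD.2 _ (cb t).
  by case: (k _) => a b a0 _; apply: contraTneq a0 => -[-> _]; rewrite ltxx.
have I2 : leb.-integrable `[0, 2 * pi]
    (EFin \o (fun t => 1 + (s * 2 ^+ n) * (Re (h (p + r%:C * expi t)) - 1))).
  apply: seg_integrable => t _; apply: cvgD; first exact: cvg_cst.
  apply: cvgM; first exact: cvg_cst.
  apply: cvgB; last exact: cvg_cst.
  exact: (pcont_Re (hc t)).
apply: (@le_trans _ _ (\int[leb]_(t in `[0, 2 * pi])
   (1 + (s * 2 ^+ n) * (Re (h (p + r%:C * expi t)) - 1)))); last first.
  apply: le_Rintegral => // t _.
  rewrite -hk// abscX.
  have E a : 0 <= a -> a `^ (s * 2 ^+ n) = (a ^+ (2 ^ n)) `^ s.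
    by move=> a0; rewrite mulrC powRrM -natrX powR_mulrn.
  have := Bernoulli_powR (absc_ge0 (h (p + r%:C * expi t))) sn.
  rewrite E ?absc_ge0//; apply: le_trans; rewrite lerD2l ler_wpM2l//.
    by rewrite mulr_ge0// ltW.
  by rewrite lerD2r (le_trans (ler_norm _))// absc_Re.
have cI (c : R) : leb.-integrable `[0, 2 * pi] (EFin \o (fun=> c)).
  by apply: seg_integrable => x _; exact: cst_continuous.
have hI : leb.-integrable `[0, 2 * pi]
    (EFin \o (fun t => Re (h (p + r%:C * expi t)))).
  by apply: seg_integrable => t _; exact: (pcont_Re (hc t)).
have I3 : leb.-integrable `[0, 2 * pi]
    (EFin \o (fun t => Re (h (p + r%:C * expi t)) - 1)).
  apply: seg_integrable => t _.
  by apply: cvgB; [exact: (pcont_Re (hc t))|exact: cvg_cst].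
rewrite RintegralD//; last first.
  apply: seg_integrable => t _.
  apply: cvgM; first exact: cvg_cst.
  by apply: cvgB; [exact: (pcont_Re (hc t))|exact: cvg_cst].
rewrite RintegralZl// RintegralB// (@mean_value_Re _ h p r0 r rr0); last first.
  by move=> z /hD[].
by rewrite !seg_Rintegral_cst// hp /= !mul1r subr0 subrr mulr0 addr0.
Qed.

(** On a ball where g stays closer to g p than 0 does, the quotient g / g p stays
    in the half-plane on which square roots can be iterated. *)
Lemma submean_powR (g : C -> C) (p : C) (r0 r s : R) :
  0 < r < r0 -> 0 < s ->
  (forall z, absc (z - p) < r0 -> exists d, cderiv g z d) ->
  (forall z, absc (z - p) < r0 -> absc (g z - g p) < absc (g p)) ->
  2 * pi * absc (g p) `^ s <=
  \int[leb]_(t in `[0, 2 * pi]) (absc (g (p + r%:C * expi t)) `^ s).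
Proof.
move=> rr0 s0 gD gp.
have r_gt0 : 0 < r0 by case/andP: rr0 => r_gt0; exact: lt_trans.
have g0 : 0 < absc (g p).
  by have := gp p; rewrite !subrr absc0; exact.
have gp0 : g p != 0 by rewrite -absc_gt0.
pose k z := (g p)^-1 * g z + 0.
have kD : root_data p r0 k.
  split=> [|z zp]; first by rewrite /k addr0 mulVf.
  split; last first.
    have [d gd] := gD z zp; exists ((g p)^-1 * d).
    exact: (cderiv_comp gd (cderiv_affine _ _ _)).
  have : absc (k z - 1) < 1.
    rewrite /k addr0 -(mulVf gp0) -mulrBr abscM abscV.
    by rewrite mulrC ltr_pdivrMr// mul1r gp.
  move/(le_lt_trans (absc_Re _)); case: (k z) => a b /=.
  by rewrite ltr_norml => /andP[]; lra.
have := submean_root_data rr0 s0 kD.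
rewrite -(@ler_pM2r _ (absc (g p) `^ s)) ?powR_gt0// => /le_trans; apply.
rewrite -RintegralZr//; last first.
  apply: seg_integrable => t _.
  apply: (@continuous_comp _ _ _ (fun t => absc (k (p + r%:C * expi t))) (@powR R ^~ s)).
    have [_ [d kd]] := kD.2 _ (circle_ball p t rr0).
    have := pcont_absc (ccont_pcont (cderiv_ccont kd) (@pcont_expi _ p r t)).
    exact.
  apply: powR_continuous; rewrite absc_gt0; have [] := kD.2 _ (circle_ball p t rr0).
  by case: (k _) => a b a0 _; apply: contraTneq a0 => -[-> _]; rewrite ltxx.
rewrite le_eqVlt; apply/orP; left; apply/eqP/eq_Rintegral => t _.
rewrite -powRM ?absc_ge0// -abscM /k addr0 mulrC mulVKf//.
Qed.

End SubMeanPower.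

(** * Translation invariance of the length *)

Section Translation.
Context {R : realType}.
Local Notation leb := (@lebesgue_measure R).
Local Notation T := (measurableTypeR R).

Lemma measurable_shift (c : R) : measurable_fun [set: T] (fun x : T => x + c : T).
Proof. by apply: measurable_funD => //; exact: measurable_cst. Qed.

(** A translate of the Lebesgue measure gives half-open intervals their length,
    which characterizes it. *)
Lemma lebesgue_measure_shift (c : R) (A : set T) : measurable A ->
  pushforward leb (fun x : T => x + c : T) A = leb A.
Proof.
move=> mA; have mp := measurable_shift c.
apply/esym; apply: (@lebesgue_measure_unique R
  (pushforward leb (fun x : T => x + c : T))) => // _ [[a b]] _ <-.
transitivity (leb `](a - c), (b - c)]).
  by rewrite !lebesgue_measure_itv/= !lte_fin ltrBlDr subrK -!EFinB opprB addrA subrK.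
congr (leb _); apply/seteqP; split => x /=;
  by rewrite !in_itv/= ltrBlDr lerBrDr.
Qed.

Lemma integral_shift (c : R) (D : set T) (f : T -> \bar R) :
  measurable D -> measurable_fun D f -> (forall x, D x -> 0 <= f x)%E ->
  (\int[leb]_(x in [set x | D (x + c)%R]) f (x + c)%R = \int[leb]_(x in D) f x)%E.
Proof.
move=> mD mf f0.
have := @ge0_integral_pushforward _ _ _ _ _ _ (measurable_shift c) leb D f mD mf.
move=> /(_ (fun x xD => f0 x (set_mem xD))) <-.
apply: eq_measure_integral; first exact: measurable_shift.
by move=> mc A mA _; exact: lebesgue_measure_shift.
Qed.

Lemma integral_periodic_shift (h : T -> \bar R) (L c : R) : 0 <= c <= L ->
  measurable_fun setT h -> (forall x, 0 <= h x)%E ->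
  (forall x, h (x + L) = h x) ->
  (\int[leb]_(x in `[0%R, L]) h (x + c)%R = \int[leb]_(x in `[0%R, L]) h x)%E.
Proof.
move=> /andP[c0 cL] mh h0 hL.
have mS (k : T -> \bar R) D : measurable_fun setT k -> measurable_fun D k.
  by apply: measurable_funS.
have mhc : measurable_fun setT (fun x : T => h (x + c)).
  by apply: (measurableT_comp mh); exact: measurable_shift.
have shift (d a b : R) : (\int[leb]_(x in `[a, b[) h (x + d)%R =
    \int[leb]_(x in `[(a + d)%R, (b + d)%R[) h x)%E.
  rewrite -(@integral_shift d `[(a + d)%R, (b + d)%R[)//; last exact: mS.
  congr integral; apply/seteqP; split => x /=;
    by rewrite !in_itv/= lerD2r ltrD2r.
have cat (a b d : R) : a <= b <= d -> (\int[leb]_(x in `[a, d[) h x =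
    \int[leb]_(x in `[a, b[) h x + \int[leb]_(x in `[b, d[) h x)%E.
  move=> /andP[ab bd]; rewrite -ge0_integral_setU//=; last 2 first.
  - exact: mS.
  - apply/disj_setPS => x /= []; rewrite !in_itv/= => /andP[_ xb] /andP[bx _].
    by move: (lt_le_trans xb bx); rewrite ltxx.
  by rewrite -itv_bndbnd_setU// bnd_simp.
rewrite -!integral_itv_bndo_bndc; try exact: mS.
rewrite shift add0r (cat c L (L + c)%R) ?cL ?lerDl//.
have -> : (\int[leb]_(x in `[L, (L + c)%R[) h x = \int[leb]_(x in `[0%R, c[) h x)%E.
  rewrite -{1}[L]add0r [(L + c)%R]addrC -shift.
  by apply: eq_integral => x _; rewrite hL.
by rewrite addeC -cat ?c0.
Qed.

End Translation.

(** * Measurability in the plane and exchange of integrals *)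

Section PlaneMeasurability.
Context {R : realType}.
Local Notation C := (R[i]).
Local Notation T := (measurableTypeR R).
Local Notation R2 := (T * T)%type.

(** An open set of the plane is a countable union of boxes with rational
    corners, which relates its topology to the product sigma-algebra. *)
Lemma measurable_open_plane (A : set R2) :
  (forall p, A p -> exists2 d : R, 0 < d &
     forall q, `|q.1 - p.1| < d -> `|q.2 - p.2| < d -> A q) ->
  measurable A.
Proof.
move=> oA.
pose box (q : rat * rat * (rat * rat)) : set R2 :=
  `]ratr q.1.1, ratr q.1.2[ `*` `]ratr q.2.1, ratr q.2.2[.
suff -> : A = \bigcup_q (if pselect (box q `<=` A) then box q else set0).
  apply: countable_bigcupT_measurable => [|q]; first exact: countableP.
  by case: pselect => ?; [apply: measurableX; exact: measurable_itv|exact: measurable0].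
apply/seteqP; split => [p Ap|p [q _]]; last first.
  by case: pselect => // qA; exact: qA.
have [d d0 dP] := oA p Ap.
have lr (x : R) : exists2 ab : rat * rat, ratr ab.1 < x < ratr ab.2 &
    x - d < ratr ab.1 /\ ratr ab.2 < x + d.
  have : x - d < x by rewrite ltrBlDr ltrDl.
  have : x < x + d by rewrite ltrDl.
  move=> /rat_in_itvoo[b] /[!in_itv]/= /andP[b1 b2].
  move=> /rat_in_itvoo[a] /[!in_itv]/= /andP[a1 a2].
  by exists (a, b) => /=; rewrite ?a2.
have [[a b] ab [a1 b1]] := lr p.1; have [[c e] ce [c1 e1]] := lr p.2.
exists ((a, b), (c, e)) => //; case: pselect => [?|].
  by split; rewrite /= in_itv.
move=> nA; exfalso; apply: nA => -[x y] [].
rewrite /= !in_itv/= => /andP[x1 x2] /andP[y1 y2].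
move: a1 b1 c1 e1 ab ce => /= a1 b1 c1 e1 /andP[? ?] /andP[? ?].
by apply: dP => /=; rewrite ltr_norml; apply/andP; split; lra.
Qed.

Lemma measurable_ccont (U : set C) (f : C -> R) :
  (forall z, U z -> exists2 d : R, 0 < d & forall w, absc (w - z) < d -> U w) ->
  (forall z, U z -> forall e, 0 < e -> exists2 d : R, 0 < d &
     forall w, absc (w - z) < d -> `|f w - f z| < e) ->
  measurable_fun (toC @^-1` U : set R2) (f \o toC).
Proof.
move=> oU fc mU; apply: (measurability _ (RGenOpens.measurableE R)) => // {mU}.
move=> _ [_ [a [b ->] <-]].
apply: measurable_open_plane => -[x y] [/= Ux]; rewrite in_itv/= => /andP[fa fb].
pose e := Num.min (f (x +i* y) - a) (b - f (x +i* y)).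
have e0 : 0 < e by rewrite lt_min !subr_gt0 fa.
have [d1 d10 d1P] := oU _ Ux; have [d2 d20 d2P] := fc _ Ux _ e0.
exists (Num.min d1 d2 / 2); first by rewrite divr_gt0// lt_min d10.
move=> [x' y'] /= xd yd.
have : absc (x' +i* y' - (x +i* y)) < Num.min d1 d2.
  by rewrite (le_lt_trans (absc_le_ReIm _))//= [Num.min _ _]splitr ltrD.
rewrite lt_min => /andP[/d1P Uw /d2P]; rewrite lt_min => /andP[].
rewrite !ltr_norml => /andP[? ?] /andP[? ?]; split => //.
by rewrite /= in_itv/=; apply/andP; split; rewrite /toC/=; lra.
Qed.

End PlaneMeasurability.

Section TrigonometricMeasurability.
Context {R : realType}.
Local Notation T := (measurableTypeR R).

Lemma measurable_cosT : measurable_fun [set: T] (@cos R : T -> T).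
Proof. by apply: continuous_measurable_fun; exact: continuous_cos. Qed.

Lemma measurable_sinT : measurable_fun [set: T] (@sin R : T -> T).
Proof. by apply: continuous_measurable_fun; exact: continuous_sin. Qed.

End TrigonometricMeasurability.

Section RectangleTonelli.
Context d1 d2 (T1 : measurableType d1) (T2 : measurableType d2) (R : realType).
Variable m1 : {sigma_finite_measure set T1 -> \bar R}.
Variable m2 : {sigma_finite_measure set T2 -> \bar R}.

Lemma tonelli_rect (A : set T1) (B : set T2) (F : T1 * T2 -> \bar R) : measurable A -> measurable B ->
  measurable_fun setT F -> (forall p, 0 <= F p)%E ->
  (\int[m1]_(x in A) \int[m2]_(y in B) F (x, y) =
   \int[m2]_(y in B) \int[m1]_(x in A) F (x, y))%E.
Proof.
move=> mA mB mF F0; pose G := F \_ (A `*` B).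
have mG : measurable_fun setT G.
  by apply/(measurable_restrictT F); [exact: measurableX|exact: measurable_funS mF].
have G0 p : (0 <= G p)%E by rewrite /G patchE; case: ifP.
transitivity (\int[m1]_x \int[m2]_y G (x, y))%E.
  rewrite integral_mkcond; apply: eq_integral => x _; rewrite patchE.
  case: ifPn => [xA|xA].
    rewrite integral_mkcond; apply: eq_integral => y _.
    by rewrite /G !patchE in_setX /= xA.
  rewrite integral0_eq// => y _.
  by rewrite /G patchE in_setX /= (negbTE xA).
rewrite fubini_tonelli//; apply/esym.
rewrite integral_mkcond; apply: eq_integral => y _; rewrite patchE.
case: ifPn => [yB|yB].
  rewrite integral_mkcond; apply: eq_integral => x _.
  by rewrite /G !patchE in_setX /= yB andbT.
rewrite integral0_eq// => x _.
by rewrite /G patchE in_setX /= (negbTE yB) andbF.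
Qed.

Lemma measurable_partial_integral (A : set T1) (F : T1 * T2 -> \bar R) : measurable A ->
  measurable_fun setT F -> (forall p, 0 <= F p)%E ->
  measurable_fun [set: T2] (fun y : T2 => \int[m1]_(x in A) F (x, y))%E.
Proof.
move=> mA mF F0.
have -> : (fun y : T2 => \int[m1]_(x in A) F (x, y))%E =
    fubini_G m1 (F \_ (A `*` setT)).
  apply/funext => y; rewrite /fubini_G [LHS]integral_mkcond.
  by apply: eq_integral => x _; rewrite !patchE in_setX in_setT andbT.
apply: measurable_fun_fubini_tonelli_G.
  apply/(measurable_restrictT F); first exact: measurableX.
  exact: measurable_funS mF.
by move=> p; rewrite patchE; case: ifP.
Qed.

End RectangleTonelli.

(** * Circle means of truncated powers *)

Section RadialMaximum.
Context {R : realType}.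
Local Notation C := (R[i]).
Local Notation leb := (@lebesgue_measure R).
Local Notation T := (measurableTypeR R).
Local Notation R2 := (T * T)%type.
Variables (g : C -> C) (s e : R).
Hypotheses (s0 : 0 < s) (e0 : 0 < e).
Hypothesis gD : forall z, absc z < 1 -> exists d, cderiv g z d.

(** Truncating from below hides the zeros of g, near which g has no holomorphic
    roots. *)
Definition trunc_powR (z : C) : R := (Num.max (absc (g z)) e) `^ s.
Local Notation u := trunc_powR.

Definition trunc_mean (r : R) : R :=
  \int[leb]_(t in `[0, 2 * pi]) u (r%:C * expi t).
Local Notation m := trunc_mean.

Lemma trunc_powR_ge0 z : 0 <= u z. Proof. exact: powR_ge0. Qed.

Lemma trunc_powR_cont z : absc z < 1 -> forall k : R, 0 < k ->
  exists2 d : R, 0 < d & forall w, absc (w - z) < d -> `|u w - u z| < k.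
Proof.
move=> z1 k k0; have [d gd] := gD z1.
have M0 : 0 < Num.max (absc (g z)) e by rewrite lt_max e0 orbT.
have [a a0 aP] := eps_continuous (@powR_continuous _ s _ M0) k0.
have [b b0 bP] := cderiv_ccont gd a0.
exists b => // w /bP gw; apply: aP.
have := le_lt_trans (le_norm_abscB _ _) gw.
move: (absc (g w)) (absc (g z)) => x y; rewrite !ltr_norml => /andP[? ?].
by rewrite !maxEle; case: ifP => ?; case: ifP => ?; apply/andP; split; lra.
Qed.

Lemma trunc_powR_curve (c : R -> C) t : absc (c t) < 1 -> pcont c t ->
  {for t, continuous (fun x => u (c x))}.
Proof.
move=> c1 cc; apply: continuous_eps => k k0.
by have [d d0 dP] := trunc_powR_cont c1 k0; have [a a0 aP] := cc _ d0;
  exists a => // x /aP /dP.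
Qed.

Lemma absc_rexpi (r t : R) : 0 <= r -> absc (r%:C * expi t) = r.
Proof. by move=> r0; rewrite abscM absc_expi mulr1 absc_real ger0_norm. Qed.

Lemma pcont_mulexpi (z : C) t : pcont (fun x => z * expi x) t.
Proof.
have K0 : 0 < 1 + absc z by rewrite ltr_pwDl// absc_ge0.
move=> k k0; have [d d0 dP] := @pcont_expi R 0 1 t _ (divr_gt0 k0 K0).
exists d => // x /dP; rewrite !add0r !mul1r ltr_pdivlMr// => A.
rewrite -mulrBr abscM (le_lt_trans _ A)// mulrC ler_wpM2l ?absc_ge0//.
by rewrite lerDr.
Qed.

Lemma trunc_circle_cont (z : C) : absc z < 1 ->
  continuous (fun t : R => u (z * expi t)).
Proof.
move=> z1 t; apply: (trunc_powR_curve (c := fun t => z * expi t)).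
  by rewrite abscM absc_expi mulr1.
exact: pcont_mulexpi.
Qed.

Lemma EFin_seg_Rintegral (h : R -> R) a b : {in `[a, b], continuous h} ->
  ((\int[leb]_(x in `[a, b]) h x)%:E = \int[leb]_(x in `[a, b]) (h x)%:E)%E.
Proof.
by move=> hc; rewrite fineK//; apply: integrable_fin_num => //; exact: seg_integrable.
Qed.

(** A circle integral over the angle only depends on the modulus of the base
    point, because its argument shifts a periodic integrand. *)
Lemma trunc_mean_radial (z : C) : absc z < 1 ->
  ((m (absc z))%:E = \int[leb]_(t in `[0%R, (2 * pi)%R]) (u (z * expi t)%R)%:E)%E.
Proof.
move=> z1; have [c [cI zE]] := polar_form z.
have r1 : absc (absc z)%:C < 1 by rewrite absc_real ger0_norm ?absc_ge0.
rewrite EFin_seg_Rintegral; last by move=> t _; exact: trunc_circle_cont.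
rewrite -(@integral_periodic_shift _ _ _ c cI).
- by apply: eq_integral => t _; rewrite addrC expiD mulrA -zE.
- apply/measurable_EFinP; apply: continuous_measurable_fun.
  exact: trunc_circle_cont.
- by move=> x; rewrite lee_fin trunc_powR_ge0.
- by move=> x; rewrite expi_per.
Qed.

(** Where h oscillates by less than e around p, either |h p| <= e and the
    truncated power has its least possible value e ^ s at p, or h does not vanish
    near p. *)
Lemma submean_trunc (h : C -> C) (p : C) (r0 r : R) : 0 < r < r0 ->
  (forall z, absc (z - p) < r0 -> exists d, cderiv h z d) ->
  (forall z, absc (z - p) < r0 -> absc (h z - h p) < e) ->
  2 * pi * (Num.max (absc (h p)) e) `^ s <=
  \int[leb]_(t in `[0, 2 * pi]) (Num.max (absc (h (p + r%:C * expi t))) e) `^ s.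
Proof.
move=> rr0 hD hosc; have pi2 : 0 <= 2 * pi :> R by rewrite mulr_ge0// pi_ge0.
have maxc (x : R) : 0 < Num.max x e by rewrite lt_max e0 orbT.
have hc t : pcont (fun u => h (p + r%:C * expi u)) t.
  have [d hd] := hD _ (circle_ball p t rr0).
  by apply: (@ccont_pcont _ h); [exact: cderiv_ccont hd|exact: pcont_expi].
have Ic (k : R -> R) : {in `[0, 2 * pi], continuous k} ->
    leb.-integrable `[0, 2 * pi] (EFin \o k) by exact: seg_integrable.
have I1 : leb.-integrable `[0, 2 * pi]
    (EFin \o (fun t => (Num.max (absc (h (p + r%:C * expi t))) e) `^ s)).
  apply: Ic => t _.
  apply: (@continuous_comp _ _ _ (fun t => Num.max (absc (h (p + r%:C * expi t))) e)
    (@powR R ^~ s)); last exact: powR_continuous.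
  apply: continuous_eps => k k0; have [d d0 dP] := hc t k k0.
  exists d => // x /dP /(le_lt_trans (le_norm_abscB _ _)).
  move: (absc _) (absc _) => a b; rewrite !ltr_norml => /andP[? ?].
  by rewrite !maxEle; case: ifP => ?; case: ifP => ?; apply/andP; split; lra.
have [hp|hp] := leP (absc (h p)) e.
  have -> (x : R) : 2 * pi * x = \int[leb]_(t in `[0, 2 * pi]) x.
    by rewrite seg_Rintegral_cst// subr0 mulrC.
  apply: le_Rintegral => //.
    by apply: Ic => t _; exact: cst_continuous.
  move=> t _; rewrite ge0_ler_powR ?nnegrE ?(ltW (maxc _)) ?(ltW e0) ?(ltW s0)//.
  by rewrite le_max lexx orbT.
have := @submean_powR _ h p r0 r s rr0 s0 hD.
move=> /(_ (fun z zp => lt_trans (hosc z zp) hp)) /le_trans; apply.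
have hk t : 0 < absc (h (p + r%:C * expi t)).
  have := hosc _ (circle_ball p t rr0); rewrite abscC => A.
  have := le_abscB (h p) (h (p + r%:C * expi t)); lra.
apply: le_Rintegral => //.
  apply: Ic => t _.
  apply: (@continuous_comp _ _ _ (fun t => absc (h (p + r%:C * expi t)))
    (@powR R ^~ s)); last exact: powR_continuous.
  by have := pcont_absc (hc t).
move=> t _; rewrite ge0_ler_powR ?nnegrE ?absc_ge0 ?(ltW (maxc _)) ?(ltW s0)//.
by rewrite le_max lexx.
Qed.

(** The sub-mean value property at each point of the circle of radius r, on
    circles of one common radius k, is integrated over the rotations of the
    plane; exchanging the integrals leaves the circle means themselves. *)
Lemma trunc_mean_submean (r r0 k : R) : 0 <= r -> r + r0 <= 1 -> 0 < k < r0 ->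
  (forall t z, absc (z - r%:C * expi t) < r0 ->
     absc (g z - g (r%:C * expi t)) < e) ->
  ((2 * pi * m r)%:E <=
   \int[leb]_(t in `[0%R, (2 * pi)%R]) (m (absc (r%:C + k%:C * expi t)%R))%:E)%E.
Proof.
move=> r_ge0 rr0 kr0 osc; have pi2 : 0 <= 2 * pi :> R by rewrite mulr_ge0// pi_ge0.
have [k_gt0 kr] := andP kr0.
have r1 : r < 1 by lra.
have c1 t : absc (r%:C + k%:C * expi t) < 1.
  rewrite (le_lt_trans (abscD _ _))// absc_rexpi ?(ltW k_gt0)//.
  by rewrite absc_real ger0_norm//; lra.
under eq_integral do rewrite trunc_mean_radial//.
have rC1 : absc r%:C < 1 by rewrite absc_real ger0_norm.
pose F (p : R2) : \bar R := (u ((r%:C + k%:C * expi p.1) * expi p.2))%:E.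
have mF : measurable_fun setT F.
  apply/measurable_EFinP.
  have -> : (fun p : R2 => u ((r%:C + k%:C * expi p.1) * expi p.2)) =
    (u \o toC) \o (fun p : R2 =>
     (((r + k * cos p.1) * cos p.2 - k * sin p.1 * sin p.2 : T),
      ((r + k * cos p.1) * sin p.2 + k * sin p.1 * cos p.2 : T))).
    apply/funext => -[x y] /=; rewrite /toC /expi /=; congr u.
    by simpc.
  pose D : set R2 := toC @^-1` [set z : C | absc z < 1].
  apply: (@measurable_comp _ _ _ _ _ _ D).
  - exact: measurable_preim_disk.
  - move=> _ [[x y] _ <-]; rewrite /D /toC /=.
    have := c1 x; rewrite -[absc _]mulr1 -(absc_expi y) -abscM.
    by rewrite /expi; simpc.
  - apply: measurable_ccont => [z z1|z z1].
      exists (1 - absc z); first by rewrite subr_gt0.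
      by move=> w wz /=; have := le_abscB w z; lra.
    exact: trunc_powR_cont.
  - have mc1 : measurable_fun [set: R2] (fun p : R2 => cos p.1 : T).
      by apply: (measurableT_comp measurable_cosT); exact: measurable_fst.
    have mc2 : measurable_fun [set: R2] (fun p : R2 => cos p.2 : T).
      by apply: (measurableT_comp measurable_cosT); exact: measurable_snd.
    have ms1 : measurable_fun [set: R2] (fun p : R2 => sin p.1 : T).
      by apply: (measurableT_comp measurable_sinT); exact: measurable_fst.
    have ms2 : measurable_fun [set: R2] (fun p : R2 => sin p.2 : T).
      by apply: (measurableT_comp measurable_sinT); exact: measurable_snd.
    apply/measurable_fun_pairP; split => /=.
      by apply: measurable_funB; do ?(apply: measurable_funM => //);
        apply: measurable_funD => //; exact: measurable_funM.
    by apply: measurable_funD; do ?(apply: measurable_funM => //);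
      apply: measurable_funD => //; exact: measurable_funM.
rewrite (@tonelli_rect _ _ _ _ _ leb leb `[0%R, (2 * pi)%R] `[0%R, (2 * pi)%R] F)//; last first.
  by move=> p; rewrite lee_fin trunc_powR_ge0.
have mrc : measurable_fun [set: T] (fun t : T => u (r%:C * expi t)).
  by apply: continuous_measurable_fun; exact: (trunc_circle_cont rC1).
have E : ((2 * pi * m r)%:E =
    \int[leb]_(t in `[0%R, (2 * pi)%R]) (2 * pi * u (r%:C * expi t))%:E)%E.
  rewrite EFinM EFin_seg_Rintegral; last first.
    by move=> t _; exact: (trunc_circle_cont rC1).
  rewrite -ge0_integralZl_EFin//.
  - by move=> t _; rewrite lee_fin trunc_powR_ge0.
  - by apply: measurable_funTS; apply/measurable_EFinP.
rewrite {}E; apply: ge0_le_integral => //.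
- by move=> t _; rewrite lee_fin mulr_ge0// trunc_powR_ge0.
- by apply: measurable_funTS; apply/measurable_EFinP; exact: measurable_funM.
- apply: (@measurable_funS _ _ _ _ setT) => //.
  apply: measurable_partial_integral => // p.
  by rewrite lee_fin trunc_powR_ge0.
move=> t _.
have gtD z : absc (z - r%:C) < r0 -> exists d, cderiv (fun z => g (z * expi t)) z d.
  move=> zr; have [d gd] : exists d, cderiv g (z * expi t) d.
    apply: gD; rewrite abscM absc_expi mulr1.
    by have := le_abscB z r%:C; rewrite absc_real ger0_norm//; lra.
  exists (d * expi t); have := cderiv_affine (expi t) 0 z.
  have -> : (fun w => expi t * w + 0) = (fun w => w * expi t :> C).
    by apply/funext => w; rewrite addr0 mulrC.
  by move=> A; exact: (cderiv_comp A gd).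
have := @submean_trunc (fun z => g (z * expi t)) r%:C r0 k kr0 gtD.
rewrite -lee_fin EFin_seg_Rintegral; last first.
  move=> x _.
  apply: (trunc_powR_curve (c := fun x => (r%:C + k%:C * expi x) * expi t)).
    by rewrite abscM absc_expi mulr1.
  have := @ccont_pcont _ (fun w => w * expi t) (fun x => r%:C + k%:C * expi x) x.
  apply; last exact: pcont_expi.
  move=> a a0; exists a => // w; by rewrite -mulrBl abscM absc_expi mulr1.
apply => z zr; apply: osc.
by rewrite -mulrBl abscM absc_expi mulr1.
Qed.

End RadialMaximum.

(** * Monotonicity of the circle means *)

Section CircleUniformity.
Context {R : realType}.
Local Notation C := (R[i]).

(** Compactness of the circle, taken as the image of a segment of angles. *)
Lemma circle_uniform (f : C -> C) (r : R) :
  (forall t : R, ccont f (r%:C * expi t)) -> forall k : R, 0 < k ->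
  exists2 d : R, 0 < d & forall t z, absc (z - r%:C * expi t) < d ->
    absc (f z - f (r%:C * expi t)) < k.
Proof.
move=> fc k k0.
pose P (d t : R) := forall z, absc (z - r%:C * expi t) < d ->
  absc (f z - f (r%:C * expi t)) < k.
have cov : \forall d \near (0 : R)^'+, `[0, 2 * pi] `<=` P d.
  have /compact_near_coveringP H := @segment_compact R 0 (2 * pi).
  apply: (H R (0 : R)^'+ P) => t _.
  have [a a0 aP] := fc t _ (divr_gt0 k0 (ltr0Sn R 1)).
  have a20 : 0 < a / 2 by rewrite divr_gt0.
  have [b b0 bP] := @pcont_expi R 0 r t _ a20.
  exists ([set t' | `|t' - t| < b], [set d | d < a / 2]) => /=.
    split; last exact: nbhs_right_lt.
    by apply/nbhs_ballP; exists b => //= x; rewrite /ball/= distrC.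
  move=> [t' d] /= [/bP tt da] z zd.
  rewrite !add0r in tt.
  have zt : absc (z - r%:C * expi t) < a.
    have -> : z - r%:C * expi t = (z - r%:C * expi t') + (r%:C * expi t' - r%:C * expi t).
      by rewrite addrA subrK.
    by rewrite (le_lt_trans (abscD _ _))// [a]splitr ltrD// (lt_trans zd).
  have tt' : absc (r%:C * expi t' - r%:C * expi t) < a.
    by rewrite (lt_trans tt)// ltr_pdivrMr// mulr_natr mulr2n ltrDl.
  have -> : f z - f (r%:C * expi t') = (f z - f (r%:C * expi t)) +
      (f (r%:C * expi t) - f (r%:C * expi t')) by rewrite addrA subrK.
  rewrite (le_lt_trans (abscD _ _))// [k]splitr ltrD//; first exact: aP.
  by rewrite abscC; exact: aP.
have [d [d0 dP]] : exists d : R, 0 < d /\ `[0, 2 * pi] `<=` P d.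
  near (0 : R)^'+ => d; exists d; split; first by [].
  by near: d.
exists d => // t.
have [t' [t'I tE]] := polar_form (expi t : C).
have -> : expi t = expi t' :> C by rewrite tE absc_expi mul1r.
by apply: dP; rewrite /= in_itv.
Unshelve. all: by end_near. Qed.

End CircleUniformity.

Section Monotonicity.
Context {R : realType}.
Local Notation C := (R[i]).
Local Notation leb := (@lebesgue_measure R).
Local Notation T := (measurableTypeR R).
Variables (g : C -> C) (s : R).
Hypothesis s0 : 0 < s.
Hypothesis gD : forall z, absc z < 1 -> exists d, cderiv g z d.

Lemma trunc_mean_cont (e x : R) : 0 < e -> `|x| < 1 ->
  {for x, continuous (trunc_mean g s e)}.
Proof.
move=> e0 x1; apply: continuous_eps => k k0.
have pi2 : 0 < 2 * pi :> R by rewrite mulr_gt0// pi_gt0.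
have uc t : ccont (fun z => (trunc_powR g s e z)%:C) (x%:C * expi t).
  move=> a a0.
  have xt1 : absc (x%:C * expi t) < 1 by rewrite abscM absc_expi mulr1 absc_real.
  have [b b0 bP] := trunc_powR_cont s e0 gD xt1 a0.
  exists b => // w /bP; by rewrite -rmorphB absc_real.
have K0 : 0 < k / 2 / (2 * pi) by rewrite !divr_gt0.
have [d d0 dP] := circle_uniform uc K0.
exists (Num.min d (1 - `|x|)); first by rewrite lt_min d0 subr_gt0.
move=> y; rewrite lt_min => /andP[yd y1].
have y1' : absc y%:C < 1.
  by rewrite absc_real; have := ler_normD (y - x) x; rewrite subrK; lra.
have x1' : absc x%:C < 1 by rewrite absc_real.
have cI z : absc z < 1 -> {in `[0, 2 * pi], continuous (fun t => trunc_powR g s e (z * expi t))}.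
  by move=> z1 t _; exact: trunc_circle_cont.
rewrite /trunc_mean -RintegralB//; try exact: seg_integrable (cI _ _).
have := @seg_Rintegral_bound R (fun t => trunc_powR g s e (y%:C * expi t) -
  trunc_powR g s e (x%:C * expi t)) 0 0 (2 * pi) (k / 2 / (2 * pi)) (ltW pi2).
rewrite mul0r !subr0 divfK ?gt_eqF// => /(_ _ _)/le_lt_trans; apply.
- by apply: continuous_inB; exact: cI.
- move=> t _; rewrite subr0; have := dP t (y%:C * expi t).
  rewrite -mulrBl abscM absc_expi mulr1 -!rmorphB !absc_real => /(_ yd).
  exact: ltW.
- by rewrite ltr_pdivrMr// mulr_natr mulr2n ltrDl.
Qed.

(** The multiple of t ^ 2 serves to make a sub-mean value inequality strict; a
    small one leaves the maximum away from b. *)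
Lemma interior_max (m : R -> R) (a b : R) : 0 <= a <= b -> b < 1 ->
  {in `[0, b], continuous m} -> m b < m a ->
  exists c D, [/\ 0 <= c, c < b, 0 < D &
    forall t, 0 <= t <= b -> m t + D * t ^+ 2 <= m c + D * c ^+ 2].
Proof.
move=> /andP[a0 ab] b1 mc mba; have b0 : 0 <= b by exact: le_trans ab.
have [D D0 DE] : exists2 D, 0 < D & m a = m b + D + D.
  exists ((m a - m b) / 2); first by rewrite divr_gt0 ?subr_gt0.
  by rewrite -addrA -splitr addrC subrK.
have [c cab cmax] : exists2 c, c \in `[0, b] &
    forall t, t \in `[0, b] -> m t + D * t ^+ 2 <= m c + D * c ^+ 2.
  apply: EVT_max => //; apply: continuous_in_subspaceT => x /set_mem /= xI.
  apply: cvgD; first exact: mc.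
  by apply: cvgM; [exact: cvg_cst|exact: exprn_continuous].
move: cab; rewrite in_itv/= => /andP[c0 cb].
exists c, D; split => //.
rewrite lt_neqAle cb andbT; apply/eqP => cbE.
have := cmax a; rewrite in_itv/= a0 ab cbE => /(_ isT).
have A1 : D * a ^+ 2 >= 0 by rewrite mulr_ge0 ?sqr_ge0// ltW.
have A2 : D * b ^+ 2 <= D by rewrite ler_piMr ?(ltW D0)// exprn_ile1// ltW.
rewrite leNgt DE => /negP; apply.
apply: (le_lt_trans (lerD (lexx _) A2)).
by rewrite -!addrA ltrD2l ltrDl ltr_wpDr.
Qed.

(** A circle mean exceeding one of a larger circle would, after adding a small
    multiple of |z| ^ 2, give a rotation invariant function with an interior
    maximum and a strict sub-mean value property. *)
Lemma trunc_mean_mono (e a b : R) : 0 < e -> 0 <= a <= b -> b < 1 ->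
  trunc_mean g s e a <= trunc_mean g s e b.
Proof.
move=> e0 /andP[a0 ab] b1; rewrite leNgt; apply/negP => mba.
pose m := trunc_mean g s e; rewrite -/(m a) -/(m b) in mba.
have pi2 : 0 < 2 * pi :> R by rewrite mulr_gt0// pi_gt0.
have mc x : `|x| < 1 -> {for x, continuous m} by exact: trunc_mean_cont.
have [c [D [c0 cltb D0 cmax]]] : exists c D, [/\ 0 <= c, c < b, 0 < D &
    forall t, 0 <= t <= b -> m t + D * t ^+ 2 <= m c + D * c ^+ 2].
  apply: (@interior_max m a b); rewrite ?a0//.
  move=> x; rewrite in_itv/= => /andP[x0 xb].
  by apply: mc; rewrite ger0_norm// (le_lt_trans xb).
have gc t : ccont g (c%:C * expi t).
  have [d gd] : exists d, cderiv g (c%:C * expi t) d.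
    by apply: gD; rewrite absc_rexpi// (lt_trans cltb).
  exact: cderiv_ccont gd.
have [d d0 dP] := circle_uniform gc e0.
pose r0 := Num.min d (b - c); have r00 : 0 < r0 by rewrite lt_min d0 subr_gt0.
have r0d : r0 <= d by rewrite ge_min lexx.
have r0b : r0 <= b - c by rewrite ge_min lexx orbT.
pose k := r0 / 2.
have kr0 : 0 < k < r0.
  by rewrite divr_gt0//= ltr_pdivrMr// mulr_natr mulr2n ltrDl.
have := trunc_mean_submean s0 e0 gD c0 (k := k) (r0 := r0).
have -> : c + r0 <= 1 by rewrite -lerBrDl (le_trans r0b)// lerD2r ltW.
move=> /(_ isT kr0 (fun t z zt => dP t z (lt_le_trans zt r0d))).
have [k0 kr] := andP kr0.
have cz t : absc (c%:C + k%:C * expi t) <= b.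
  rewrite (le_trans (abscD _ _))// absc_rexpi ?(ltW k0)// absc_real ger0_norm//.
  by rewrite -lerBrDl (le_trans (ltW kr)).
have mcI : {in `[0, 2 * pi], continuous (fun t : R => m (absc (c%:C + k%:C * expi t)))}.
  move=> t _; apply: (@continuous_comp _ _ _ (fun t => absc (c%:C + k%:C * expi t)) m).
    by have := pcont_absc (pcont_expi (c%:C) k t).
  by apply: mc; rewrite ger0_norm ?absc_ge0// (le_lt_trans (cz t)).
rewrite -EFin_seg_Rintegral// lee_fin leNgt => /negP; apply.
have cosI : {in `[0, 2 * pi], continuous (fun t : R => Re (0 + 1%:C * expi t))}.
  by move=> t _; exact: (pcont_Re (pcont_expi 0 1 t)).
(* the mean of the cosine is the value at 0 of the real part of the identity *)
have cos0 : \int[leb]_(t in `[0, 2 * pi]) Re (0 + 1%:C * expi t) = 0.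
  rewrite (@mean_value_Re _ id 0 2 1) ?mul0r//; first by rewrite ltr01 ltr1n.
  move=> z _; exists 1; have := cderiv_affine 1 0 z.
  by have -> : (fun w : C => 1 * w + 0) = id by apply/funext => w; rewrite mul1r addr0.
have cstI (x : R) : {in `[0, 2 * pi], continuous (fun _ : R => x)}.
  by move=> t _; exact: cst_continuous.
have QI : {in `[0, 2 * pi], continuous
    (fun t : R => (m c - D * k ^+ 2) - (2 * D * c * k) * Re (0 + 1%:C * expi t))}.
  by move=> t tI; apply: cvgB; [exact: cvg_cst|apply: cvgM; [exact: cvg_cst|exact: cosI]].
apply: (@le_lt_trans _ _ (\int[leb]_(t in `[0, 2 * pi])
   ((m c - D * k ^+ 2) - (2 * D * c * k) * Re (0 + 1%:C * expi t)))).
  apply: le_Rintegral => //; try exact: seg_integrable.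
  move=> t _; have := cmax (absc (c%:C + k%:C * expi t)).
  rewrite absc_ge0 cz => /(_ isT).
  have -> : absc (c%:C + k%:C * expi t) ^+ 2 = c ^+ 2 + k ^+ 2 + 2 * c * k * cos t.
    rewrite absc_sqr /expi /=; simpc => /=.
    transitivity (c ^+ 2 + k ^+ 2 * (cos t ^+ 2 + sin t ^+ 2) + 2 * c * k * cos t).
      by ring.
    by rewrite cos2Dsin2 mulr1.
  rewrite /expi; simpc => /=; rewrite -lerBrDr => /le_trans; apply.
  by rewrite le_eqVlt; apply/orP; left; apply/eqP; ring.
rewrite RintegralB//; last 2 first.
- exact: seg_integrable.
- by apply: seg_integrable => t tI; apply: cvgM; [exact: cvg_cst|exact: cosI].
rewrite RintegralZl//; last exact: seg_integrable.
rewrite cos0 mulr0 subr0 seg_Rintegral_cst ?(ltW pi2)// subr0.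
rewrite -/(m c); have : m c - D * k ^+ 2 < m c.
  by rewrite ltrBlDr ltrDl mulr_gt0// exprn_gt0.
clear -pi2; move: (m c) (_ - _) => x y yx.
by rewrite [ltRHS]mulrC ltr_pM2r.
Qed.

Definition power_mean (r : R) : \bar R :=
  (\int[leb]_(t in `[0%R, (2 * pi)%R]) (absc (g (r%:C * expi t)) `^ s)%:E)%E.

Lemma measurable_circle_powR (r : R) : `|r| < 1 ->
  measurable_fun [set: T] (fun t : T => absc (g (r%:C * expi t)) `^ s).
Proof.
move=> r1; apply: (measurableT_comp (measurable_powR _)).
apply: continuous_measurable_fun => t.
have [d gd] : exists d, cderiv g (r%:C * expi t) d.
  by apply: gD; rewrite abscM absc_expi mulr1 absc_real.
have := pcont_absc (ccont_pcont (c := fun t => r%:C * expi t) (cderiv_ccont gd)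
  (@pcont_mulexpi _ _ _)).
exact.
Qed.

(** Truncation at e increases the integral over a circle by at most
    2 pi * e ^ s. *)
Lemma power_mean_mono (a b : R) : 0 <= a <= b -> b < 1 ->
  (power_mean a <= power_mean b)%E.
Proof.
move=> /andP[a0 ab] b1; have b0 : 0 <= b by exact: le_trans ab.
have pi2 : 0 < 2 * pi :> R by rewrite mulr_gt0// pi_gt0.
apply/lee_addgt0Pr => k k0.
(* the truncation level at which the error is exactly k *)
pose e := (k / (2 * pi)) `^ s^-1.
have e0 : 0 < e by rewrite powR_gt0// divr_gt0.
have es : e `^ s = k / (2 * pi).
  by rewrite /e -powRrM mulVf ?gt_eqF// powRr1// divr_ge0// ltW.
have maxc x : 0 <= Num.max x e by rewrite le_max (ltW e0) orbT.
have rc x : 0 <= x <= b -> absc x%:C < 1.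
  by move=> /andP[x0 xb]; rewrite absc_real ger0_norm//; lra.
have mt x : 0 <= x <= b -> measurable_fun [set: T]
    (fun t : T => (trunc_powR g s e (x%:C * expi t))%:E).
  move=> xb; apply/measurable_EFinP.
  have := continuous_measurable_fun (trunc_circle_cont (s := s) e0 gD (rc x xb)).
  exact.
have mg x : 0 <= x <= b -> measurable_fun [set: T]
    (fun t : T => (absc (g (x%:C * expi t)) `^ s)%:E).
  move=> xb; apply/measurable_EFinP; apply: measurable_circle_powR.
  by have := rc x xb; rewrite absc_real.
have ra : 0 <= a <= b by rewrite a0.
have rb : 0 <= b <= b by rewrite b0 lexx.
have mE x : 0 <= x <= b -> ((trunc_mean g s e x)%:E =
    \int[leb]_(t in `[0%R, (2 * pi)%R]) (trunc_powR g s e (x%:C * expi t))%:E)%E.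
  move=> xb; rewrite EFin_seg_Rintegral// => t _.
  exact: (trunc_circle_cont (s := s) e0 gD (rc x xb)).
apply: (@le_trans _ _ (trunc_mean g s e a)%:E).
  rewrite mE// /power_mean; apply: ge0_le_integral => //.
  - by move=> t _; rewrite lee_fin powR_ge0.
  - exact: measurable_funS (mg _ ra).
  - exact: measurable_funS (mt _ ra).
  - move=> t _; rewrite lee_fin ge0_ler_powR ?nnegrE ?absc_ge0 ?(ltW s0)//.
    by rewrite le_max lexx.
apply: (@le_trans _ _ (trunc_mean g s e b)%:E).
  by rewrite lee_fin; apply: trunc_mean_mono.
have -> : k%:E = (\int[leb]_(t in `[0%R, (2 * pi)%R]) (cst (e `^ s)%:E t))%E.
  rewrite integral_cst//= lebesgue_measure_itv/= lte_fin pi2 -EFinB subr0 -EFinM.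
  by rewrite es divfK// gt_eqF.
rewrite mE// /power_mean -ge0_integralD//; try by move=> t _; rewrite lee_fin powR_ge0.
  2: exact: measurable_funS (mg _ rb).
apply: ge0_le_integral => //.
- by move=> t _; rewrite lee_fin powR_ge0.
- exact: measurable_funS (mt _ rb).
- by apply: emeasurable_funD => //; exact: measurable_funS (mg _ rb).
move=> t _; rewrite -EFinD lee_fin /trunc_powR maxEle; case: ifP => _.
  by rewrite lerDr powR_ge0.
by rewrite lerDl powR_ge0.
Qed.

End Monotonicity.

(** * Rotation invariance of area and the area of disks *)

Section PlaneRotation.
Context {R : realType}.
Local Notation leb := (@lebesgue_measure R).
Local Notation T := (measurableTypeR R).
Local Notation R2 := (T * T)%type.
Local Notation leb2 := (leb \x leb)%E.
Implicit Types F : R2 -> \bar R.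

Lemma measurable_lin (a b : R) :
  measurable_fun [set: R2] (fun p : R2 => a * p.1 + b * p.2 : T).
Proof.
apply: measurable_funD; apply: measurable_funM; try exact: measurable_cst.
- exact: measurable_fst.
- exact: measurable_snd.
Qed.

Lemma measurable_linear_map (a b c d : R) : measurable_fun [set: R2]
  (fun p : R2 => ((a * p.1 + b * p.2, c * p.1 + d * p.2) : R2)).
Proof. by apply/measurable_fun_pairP; split; exact: measurable_lin. Qed.

Lemma measurable_comp_lin F (a b c d : R) : measurable_fun setT F ->
  measurable_fun setT (fun p : R2 => F (a * p.1 + b * p.2, c * p.1 + d * p.2)).
Proof.
by move=> mF; apply: (measurableT_comp mF); exact: measurable_linear_map.
Qed.

Lemma integral_hshear F (a : R) : measurable_fun setT F ->
  (forall p, 0 <= F p)%E ->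
  (\int[leb2]_p F (p.1 + a * p.2, p.2)%R = \int[leb2]_p F p)%E.
Proof.
move=> mF F0.
have mF' : measurable_fun setT (fun p : R2 => F (p.1 + a * p.2, p.2)).
  have := measurable_comp_lin 1 a 0 1 mF.
  by under eq_fun do rewrite !mul1r mul0r add0r.
rewrite !fubini_tonelli2//; apply: eq_integral => y _.
rewrite /fubini_G/= -(@integral_shift _ (a * y) setT (fun x => F (x, y)))//.
by apply: (measurableT_comp mF); exact: measurable_pair2.
Qed.

Lemma integral_vshear F (a : R) : measurable_fun setT F ->
  (forall p, 0 <= F p)%E ->
  (\int[leb2]_p F (p.1, p.2 + a * p.1)%R = \int[leb2]_p F p)%E.
Proof.
move=> mF F0.
have mF' : measurable_fun setT (fun p : R2 => F (p.1, p.2 + a * p.1)).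
  have := measurable_comp_lin 1 0 a 1 mF.
  by under eq_fun do rewrite !mul1r mul0r addr0 addrC.
rewrite !fubini_tonelli1//; apply: eq_integral => x _.
rewrite /fubini_F/= -(@integral_shift _ (a * x) setT (fun y => F (x, y)))//.
by apply: (measurableT_comp mF); exact: measurable_pair1.
Qed.

(** A rotation by an angle other than pi is a product of three shears, which
    preserve area by translation invariance along lines; the rotation by pi is
    the square of a quarter turn. *)
Lemma integral_rotation F (c d : R) : c ^+ 2 + d ^+ 2 = 1 ->
  measurable_fun setT F -> (forall p, 0 <= F p)%E ->
  (\int[leb2]_p F (c * p.1 - d * p.2, d * p.1 + c * p.2)%R = \int[leb2]_p F p)%E.
Proof.
move=> cd mF F0; wlog c1 : c d cd F mF F0 / c != -1 => [wl|].
  have [cN1|] := eqVneq c (-1); last exact: wl.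
  have d0 : d = 0.
    by apply/eqP; rewrite -sqrf_eq0 -[_ ^+ 2](addKr (c ^+ 2)) cd cN1 sqrrN expr1n addNr.
  have h01 : (0 : R) ^+ 2 + 1 ^+ 2 = 1 by rewrite expr0n expr1n add0r.
  have zN : (0 : R) != -1 by rewrite eq_sym oppr_eq0 oner_neq0.
  rewrite -(wl 0 1 h01 F mF F0 zN).
  rewrite -(wl 0 1 h01 (fun p : R2 => F (0 * p.1 - 1 * p.2, 1 * p.1 + 0 * p.2)))//.
  - by apply: eq_integral => p _; rewrite cN1 d0 /=; congr (F (_, _)); ring.
  - by have := measurable_comp_lin 0 (-1) 1 0 mF; under eq_fun do rewrite mulNr.
have c10 : 1 + c != 0 by rewrite addrC addr_eq0.
pose a := - d / (1 + c).
have aE : a * (1 + c) = - d by rewrite divfK.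
have ad : 1 + a * d = c.
  apply/(mulIf c10); rewrite mulrDl mul1r mulrAC aE mulNr -expr2.
  by rewrite -[d ^+ 2](addKr (c ^+ 2)) cd; ring.
pose F1 (p : R2) := F (p.1 + a * p.2, p.2).
pose F2 (p : R2) := F1 (p.1, p.2 + d * p.1).
have mF1 : measurable_fun setT F1.
  have := measurable_comp_lin 1 a 0 1 mF.
  by under eq_fun do rewrite !mul1r mul0r add0r.
have mF2 : measurable_fun setT F2.
  have := measurable_comp_lin 1 0 d 1 mF1.
  by under eq_fun do rewrite !mul1r mul0r addr0 addrC.
have F10 p : (0 <= F1 p)%E by exact: F0.
have F20 p : (0 <= F2 p)%E by exact: F0.
rewrite -(integral_hshear a mF F0) -/F1 -(integral_vshear d mF1 F10).
rewrite -(integral_hshear a mF2 F20).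
apply: eq_integral => -[x y] _; rewrite /F2 /F1 /=.
have yE : y + d * (x + a * y) = d * x + c * y by rewrite -ad; ring.
rewrite yE; congr (F (_, _)).
have -> : x + a * y + a * (d * x + c * y) = (1 + a * d) * x + a * (1 + c) * y.
  by ring.
by rewrite ad aE mulNr.
Qed.

End PlaneRotation.

Section DiskArea.
Context {R : realType}.
Local Notation leb := (@lebesgue_measure R).
Local Notation T := (measurableTypeR R).

Lemma sin_homo : {in `[- (pi / 2), pi / 2] &, {homo (@sin R) : x y / x < y}}.
Proof. by move=> x y xI yI xy; rewrite ltr_sin. Qed.

(** Substituting x = r * sin t leaves 2 * r ^ 2 * cos ^ 2 t, with primitive
    r ^ 2 * (t + sin t * cos t). *)
Lemma semicircle_integral (r : R) : 0 < r ->
  (\int[leb]_(x in `[(- r)%R, r]) (2 * Num.sqrt (r ^+ 2 - x ^+ 2))%:E =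
   (pi * r ^+ 2)%:E)%E.
Proof.
move=> r0; have pi0 := pi_gt0 R.
have pp : - (pi / 2) < pi / 2 :> R by rewrite gtrN// divr_gt0.
pose F (t : R) := r * sin t.
have dF t : is_derive t (1 : R) F (r * cos t).
  exact: is_deriveZ.
have F'E : derive1 F = (fun t => r * cos t).
  by apply/funext => t; rewrite derive1E; exact: (@derive_val _ _ _ _ _ _ _ (dF t)).
have Fc : continuous F.
  by move=> t; apply: cvgM; [exact: cvg_cst|exact: continuous_sin].
have F'c : continuous (fun t : R => r * cos t).
  by move=> t; apply: cvgM; [exact: cvg_cst|exact: continuous_cos].
pose G x := 2 * Num.sqrt (r ^+ 2 - x ^+ 2).
have Gc : continuous G.
  move=> x; apply: cvgM; first exact: cvg_cst.
  have A : {for x, continuous (fun x : R => r ^+ 2 - x ^+ 2)}.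
    by apply: cvgB; [exact: cvg_cst|exact: exprn_continuous].
  exact: (continuous_comp A (@sqrt_continuous R _)).
have Fa : F (- (pi / 2)) = - r by rewrite /F sinN sin_pihalf mulrN1.
have Fb : F (pi / 2) = r by rewrite /F sin_pihalf mulr1.
have := @integration_by_substitution_increasing R F G (- (pi / 2)) (pi / 2) (ltW pp).
rewrite Fa Fb F'E => -> //; first last.
- by apply: continuous_subspaceT.
- split => [t _|//|//]; first by [].
  + by apply: cvg_at_right_filter; exact: Fc.
  + by apply: cvg_at_left_filter; exact: Fc.
- apply/cvg_ex; exists (r * cos (pi / 2)); apply: cvg_at_left_filter; exact: F'c.
- apply/cvg_ex; exists (r * cos (- (pi / 2))); apply: cvg_at_right_filter; exact: F'c.
- by move=> x y xI yI xy; rewrite ltr_pM2l// sin_homo.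
pose H (t : R) := r ^+ 2 * (t + sin t * cos t).
have dH t : is_derive t (1 : R) H (2 * r ^+ 2 * cos t ^+ 2).
  have -> : 2 * r ^+ 2 * cos t ^+ 2 =
      r ^+ 2 *: (1 + (sin t *: - sin t + cos t *: cos t)).
    have := cos2Dsin2 t; rewrite /GRing.scale/= => c2.
    transitivity (r ^+ 2 * ((cos t ^+ 2 + sin t ^+ 2) + cos t ^+ 2 - sin t ^+ 2)).
      by ring.
    by rewrite c2; ring.
  exact: is_deriveZ.
have H'E : derive1 H = (fun t => 2 * r ^+ 2 * cos t ^+ 2).
  by apply/funext => t; rewrite derive1E; exact: (@derive_val _ _ _ _ _ _ _ (dH t)).
have Hc : continuous H.
  by move=> t; apply/differentiable_continuous/derivable1_diffP; case: (dH t).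
transitivity (\int[leb]_(t in `[(- (pi / 2))%R, (pi / 2)%R]) (2 * r ^+ 2 * cos t ^+ 2)%:E)%E.
  apply: eq_integral => t /set_mem /=; rewrite in_itv/= => tI.
  rewrite /G /F !fctE /=; congr (_%:E).
  have -> : r ^+ 2 - (r * sin t) ^+ 2 = (r * cos t) ^+ 2.
    rewrite !exprMn -[X in X - _]mulr1 -(cos2Dsin2 t); ring.
  rewrite sqrtr_sqr ger0_norm; last by rewrite mulr_ge0 ?(ltW r0)// cos_ge0_pihalf.
  by ring.
rewrite (@continuous_FTC2 _ _ H _ _ pp).
- by rewrite /H sinN cosN cos_pihalf !mulr0 !addr0 -EFinB; congr (_%:E); field.
- apply: continuous_subspaceT => t; apply: cvgM; first exact: cvg_cst.
  have := continuous_comp (@continuous_cos R t) (@exprn_continuous R 2 (cos t)).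
  exact.
- split => [t _| |]; first by case: (dH t).
  + by apply: cvg_at_right_filter; exact: Hc.
  + by apply: cvg_at_left_filter; exact: Hc.
- by move=> t _; rewrite H'E.
Qed.

End DiskArea.

(** * The image of area under 1 - |p| ^ 2 *)

Section PolarCoordinates.
Context {R : realType}.
Local Notation leb := (@lebesgue_measure R).
Local Notation T := (measurableTypeR R).
Local Notation R2 := (T * T)%type.
Local Notation leb2 := (leb \x leb)%E.

Lemma lt_norm_sqrt (y z : R) : (`|y| < Num.sqrt z) = (y ^+ 2 < z).
Proof.
have [z0|z0] := ltP 0 z; first by rewrite -sqrtr_sqr ltr_sqrt.
rewrite ler0_sqrtr// normr_lt0; apply/esym/negbTE; rewrite -leNgt.
by rewrite (le_trans z0)// sqr_ge0.
Qed.

Lemma measurable_normsq :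
  measurable_fun [set: R2] (fun p : R2 => p.1 ^+ 2 + p.2 ^+ 2 : T).
Proof.
by apply: measurable_funD; apply: measurable_funX;
  [exact: measurable_fst|exact: measurable_snd].
Qed.

Lemma measurable_normsq_lt (c : R) :
  measurable [set p : R2 | p.1 ^+ 2 + p.2 ^+ 2 < c].
Proof.
rewrite -[X in measurable X]setTI.
have -> : [set p : R2 | p.1 ^+ 2 + p.2 ^+ 2 < c] =
    (fun p : R2 => p.1 ^+ 2 + p.2 ^+ 2 : T) @^-1` `]-oo, c[.
  by apply/seteqP; split => p /=; rewrite in_itv.
by apply: measurable_normsq.
Qed.

Lemma disk_area (c : R) :
  (leb2 [set p : R2 | (p.1 ^+ 2 + p.2 ^+ 2 < c)%R] = (pi * Num.max c 0)%:E)%E.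
Proof.
have [c0|c0] := leP c 0.
  rewrite mulr0; have -> : [set p : R2 | p.1 ^+ 2 + p.2 ^+ 2 < c] = set0.
    apply/seteqP; split => // p /= pc.
    have := lt_le_trans pc c0; rewrite ltNge => /negP; apply.
    by rewrite addr_ge0// sqr_ge0.
  by rewrite measure0.
have r0 : 0 < Num.sqrt c by rewrite sqrtr_gt0.
rewrite -{2}(sqr_sqrtr (ltW c0)) -semicircle_integral// sqr_sqrtr ?(ltW c0)//.
rewrite /product_measure1 [RHS]integral_mkcond; apply: eq_integral => x _ /=.
have -> : xsection [set p : R2 | p.1 ^+ 2 + p.2 ^+ 2 < c] x =
    `](- Num.sqrt (c - x ^+ 2)), (Num.sqrt (c - x ^+ 2))[%classic.
  apply/seteqP; split => y; rewrite /xsection /= in_itv/= -ltr_norml lt_norm_sqrt.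
    by move/set_mem => /=; rewrite ltrBrDl.
  by rewrite ltrBrDl => ?; apply/mem_set.
rewrite lebesgue_measure_itv/= lte_fin patchE.
have -> : (if (- Num.sqrt (c - x ^+ 2) < Num.sqrt (c - x ^+ 2))%R
    then (Num.sqrt (c - x ^+ 2))%:E - (- Num.sqrt (c - x ^+ 2))%:E else 0)%E
    = (2 * Num.sqrt (c - x ^+ 2))%:E.
  rewrite -EFinB opprK -mulr2n mulr_natl; case: ltP => // A; congr (_%:E).
  have := sqrtr_ge0 (c - x ^+ 2) => B.
  have -> : Num.sqrt (c - x ^+ 2) = 0 by apply/eqP; rewrite eq_le B; lra.
  by rewrite mul0rn.
case: ifPn => //; rewrite notin_setE /= in_itv/= => /negP.
rewrite -ler_norml -ltNge => A.
rewrite ler0_sqrtr ?mulr0// subr_le0.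
rewrite -[c]sqr_sqrtr ?(ltW c0)// -[x ^+ 2]real_normK ?num_real//.
by rewrite ler_pXn2r ?nnegrE ?sqrtr_ge0// ltW.
Qed.

Definition radial (p : R2) : T := 1 - (p.1 ^+ 2 + p.2 ^+ 2).

Lemma measurable_radial : measurable_fun [set: R2] radial.
Proof. by apply: measurable_funB => //; exact: measurable_normsq. Qed.

(** The area of a centered disk is pi times its squared radius, so 1 - |p| ^ 2
    carries normalized area to length. *)
Lemma pushforward_radial (A : set T) : measurable A -> A `<=` `]-oo, 1] ->
  pushforward dA radial A = leb A.
Proof.
move=> mA A1.
(* nothing is carried beyond 1: adding length there gives a measure on the line
   that can be compared with the Lebesgue measure on all half-open intervals *)
have mU : measurable (`]1, +oo[%classic : set T) by exact: measurable_itv.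
have key (a b : R) : a <= b -> (pushforward dA radial `]a, b] =
    (Num.max (1 - a) 0 - Num.max (1 - b) 0)%:E)%E.
  move=> ab; transitivity ((pi^-1)%:E * leb2 (radial @^-1` `]a, b]%classic))%E => //.
  have -> : radial @^-1` `]a, b] = [set p : R2 | (p.1 ^+ 2 + p.2 ^+ 2 < 1 - a)%R] `\`
      [set p : R2 | (p.1 ^+ 2 + p.2 ^+ 2 < 1 - b)%R].
    apply/seteqP; split => p; rewrite /radial /= in_itv/=.
      by move=> /andP[? ?]; split; [|apply/negP; rewrite -leNgt]; lra.
    by move=> [? /negP]; rewrite -leNgt => ?; apply/andP; split; lra.
  have mA' := measurable_normsq_lt (1 - a); have mB' := measurable_normsq_lt (1 - b).
  have fin : (leb2 [set p : R2 | (p.1 ^+ 2 + p.2 ^+ 2 < 1 - a)%R] < +oo)%E.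
    by have := disk_area (1 - a) => ->; rewrite ltry.
  have -> : (leb2 ([set p : R2 | (p.1 ^+ 2 + p.2 ^+ 2 < 1 - a)%R] `\`
      [set p : R2 | (p.1 ^+ 2 + p.2 ^+ 2 < 1 - b)%R]) =
      leb2 [set p : R2 | (p.1 ^+ 2 + p.2 ^+ 2 < 1 - a)%R] -
      leb2 [set p : R2 | (p.1 ^+ 2 + p.2 ^+ 2 < 1 - b)%R])%E.
    have BA : [set p : R2 | (p.1 ^+ 2 + p.2 ^+ 2 < 1 - b)%R] `<=`
        [set p : R2 | (p.1 ^+ 2 + p.2 ^+ 2 < 1 - a)%R].
      by move=> p /= /lt_le_trans; apply; rewrite lerD2l lerN2.
    have := measureD mA' mB' fin; rewrite (setIidr BA).
    exact.
  rewrite !disk_area.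
  rewrite -EFinB -EFinM -mulrBr mulrA mulVf ?mul1r//.
  by rewrite gt_eqF// pi_gt0.
have := @lebesgue_measure_unique R
  (measure_add (pushforward dA radial) (mrestr leb mU)).
move=> /(_ measurable_radial) => U.
rewrite {}U => [||//]; last first.
  move=> _ [[a b] _ <-].
  transitivity (pushforward dA radial `]a, b] + mrestr leb mU `]a, b])%E; last first.
    exact/esym/measure_addE.
  rewrite lebesgue_measure_itv/= lte_fin.
  case: (ltP a b) => ab; last first.
    rewrite set_itv_ge ?bnd_simp -?leNgt//.
    by rewrite /pushforward /mrestr preimage_set0 set0I !measure0 adde0.
  rewrite key ?(ltW ab)// /mrestr.
  have -> : `]a, b]%classic `&` `]1, +oo[%classic = `](Num.max a 1), b]%classic :> set R.
    apply/seteqP; split => x /=; rewrite !in_itv/= ?andbT gt_max.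
      by move=> [/andP[-> ->] ->].
    by move=> /andP[/andP[-> ->] ->].
  rewrite lebesgue_measure_itv/= lte_fin.
  have [b1|b1] := leP b 1.
    have a1 : a <= 1 by exact: le_trans (ltW ab) b1.
    rewrite (max_r a1) ltNge b1 /= adde0 !max_l ?subr_ge0// -EFinB.
    by congr (_%:E); ring.
  have [a1|a1] := leP 1 a.
    rewrite ?(max_l a1) ab !max_r ?subr_le0 ?(ltW b1)// subrr add0e -EFinB//.
  rewrite ?(max_r (ltW a1)) b1 max_l ?subr_ge0 ?(ltW a1)//.
  rewrite max_r ?subr_le0 ?(ltW b1)// -!EFinB -EFinD.
  by congr (_%:E); ring.
transitivity (pushforward dA radial A + mrestr leb mU A)%E; last first.
  exact/esym/measure_addE.
rewrite /mrestr.
have -> : A `&` `]1, +oo[%classic = set0.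
  apply/seteqP; split => // x [/A1 /=]; rewrite !in_itv/= andbT => x1.
  by rewrite ltNge x1.
by rewrite measure0 adde0.
Qed.

End PolarCoordinates.

(** * Polar coordinates *)

Section PolarIntegral.
Context {R : realType}.
Local Notation C := (R[i]).
Local Notation leb := (@lebesgue_measure R).
Local Notation T := (measurableTypeR R).
Local Notation R2 := (T * T)%type.
Local Notation leb2 := (leb \x leb)%E.

(** The product measure under a name of its own, which carries the
    sigma-finiteness required to exchange an integral over the plane with one
    over the angles. *)
Definition area : set R2 -> \bar R := leb2.

HB.instance Definition _ := Measure.on area.

Lemma area_sigma_finite : sigma_finite setT area.
Proof.
have /sigma_finiteP[F [TF ndF Foo]] := sigma_finiteT leb.
exists (fun n => F n `*` F n).
  rewrite -setXTT TF predeqE => -[x y]; split; last first.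
    by move=> [n _ []/= ? ?]; split; exists n.
  move=> [/= [n _ Fnx] [k _ Gky]]; exists (maxn n k) => //; split.
  - by move: x Fnx; exact/subsetPset/ndF/leq_maxl.
  - by move: y Gky; exact/subsetPset/ndF/leq_maxr.
move=> k; have [mF F_fin] := Foo k; split; first exact: measurableX.
by rewrite /area product_measure1E// lte_mul_pinfty// ge0_fin_numE.
Qed.

HB.instance Definition _ := Measure_isSigmaFinite.Build _ _ _ area area_sigma_finite.

Definition polar (r t : R) : R2 := (r * cos t, r * sin t).

Lemma toC_polar (r t : R) : toC (polar r t) = r%:C * expi t.
Proof. by rewrite /toC /polar /expi; simpc. Qed.

Lemma measurable_sqrtT : measurable_fun [set: T] (@Num.sqrt R : T -> T).
Proof. by apply: continuous_measurable_fun; exact: sqrt_continuous. Qed.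

Lemma measurable_polar_radius :
  measurable_fun [set: R2] (fun p : R2 => polar (Num.sqrt (1 - p.2)) p.1).
Proof.
have mr : measurable_fun [set: R2] (fun p : R2 => Num.sqrt (1 - p.2) : T).
  apply: (measurableT_comp measurable_sqrtT).
  by apply: measurable_funB => //; exact: measurable_snd.
apply/measurable_fun_pairP; split; apply: measurable_funM => //=.
- by apply: (measurableT_comp measurable_cosT); exact: measurable_fst.
- by apply: (measurableT_comp measurable_sinT); exact: measurable_fst.
Qed.

Lemma disk_radial : toC @^-1` disk = radial @^-1` `]0, 1] :> set R2.
Proof.
have absc1E (p : R2) : (absc (toC p) < 1) = (p.1 ^+ 2 + p.2 ^+ 2 < 1).
  rewrite -[LHS](@ltr_pXn2r _ 2)// ?nnegrE ?absc_ge0// expr1n.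
  by rewrite (absc_sqr (toC p)).
have sq0 (p : R2) : 0 <= p.1 ^+ 2 + p.2 ^+ 2 by rewrite addr_ge0 ?sqr_ge0.
apply/seteqP; split => p; rewrite /disk /radial /= in_itv/= absc1E => p1.
  by rewrite subr_gt0 p1 gerBl sq0.
by move: p1; rewrite subr_gt0 => /andP[].
Qed.

(** Integrating over all rotations of the plane multiplies the integral by
    2 pi, by rotation invariance, and replaces the integrand by its integral
    over the circle through each point, a function psi of 1 - |p| ^ 2.  The
    integral of psi is the one over ]0, 1[ by the image measure. *)
Lemma polar_integral (F : R2 -> \bar R) : measurable_fun setT F ->
  (forall p, 0 <= F p)%E ->
  (\int[dA]_(p in toC @^-1` disk) F p =
   ((2 * pi)^-1)%:E * \int[leb]_(x in `]0%R, 1%R[)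
     \int[leb]_(t in `[0%R, (2 * pi)%R]) F (polar (Num.sqrt (1 - x)) t))%E.
Proof.
move=> mF F0; have pi2 : 0 < 2 * pi :> R by rewrite mulr_gt0// pi_gt0.
pose I := `[0%R, (2 * pi)%R]%classic : set T.
have mI : measurable I by exact: measurable_itv.
pose D : set R2 := toC @^-1` disk.
have mD : measurable D := measurable_preim_disk.
pose G := F \_ D.
have mG : measurable_fun setT G by apply/(measurable_restrictT F); last exact: measurable_funTS.
have G0 p : (0 <= G p)%E by rewrite /G patchE; case: ifP.
pose psi (x : T) := (\int[leb]_(t in I) G (polar (Num.sqrt (1 - x)) t))%E.
have mpsi : measurable_fun setT psi.
  apply: (@measurable_partial_integral _ _ _ _ _ leb I
    (fun p : R2 => G (polar (Num.sqrt (1 - p.2)) p.1))) => //.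
  exact: (measurableT_comp mG measurable_polar_radius).
have psi0 x : (0 <= psi x)%E by apply: integral_ge0.
pose rot (tp : T * R2) : R2 := (cos tp.1 * tp.2.1 - sin tp.1 * tp.2.2,
  sin tp.1 * tp.2.1 + cos tp.1 * tp.2.2).
have mrot : measurable_fun [set: T * R2] rot.
  have m1 : measurable_fun [set: T * R2] (fun tp : T * R2 => cos tp.1 : T).
    by apply: (measurableT_comp measurable_cosT); exact: measurable_fst.
  have m2 : measurable_fun [set: T * R2] (fun tp : T * R2 => sin tp.1 : T).
    by apply: (measurableT_comp measurable_sinT); exact: measurable_fst.
  have m3 : measurable_fun [set: T * R2] (fun tp : T * R2 => tp.2.1 : T).
    by apply: (measurableT_comp measurable_fst); exact: measurable_snd.
  have m4 : measurable_fun [set: T * R2] (fun tp : T * R2 => tp.2.2 : T).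
    by apply: (measurableT_comp measurable_snd); exact: measurable_snd.
  apply/measurable_fun_pairP; split.
    by apply: measurable_funB; apply: measurable_funM.
  by apply: measurable_funD; apply: measurable_funM.
have toC_rot t p : toC (rot (t, p)) = toC p * expi t.
  by rewrite /toC /rot /expi /=; simpc; congr (_ +i* _); ring.
(* rotating p by all angles describes its circle, from the argument of p on *)
have spin p : (\int[leb]_(t in I) G (rot (t, p)) = ((psi \o radial) \_ D) p)%E.
  rewrite patchE; case: ifPn => [/set_mem pD|pD]; last first.
    rewrite integral0_eq// => t _; rewrite /G patchE ifF//.
    apply/negbTE/negP => /set_mem qD; move/negP: pD; apply; apply/mem_set.
    have : absc (toC (rot (t, p))) < 1 by exact: qD.
    by rewrite toC_rot abscM absc_expi mulr1.
  have [c [cI pE]] := polar_form (toC p).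
  have rE : Num.sqrt (1 - radial p) = absc (toC p).
    by rewrite /radial opprB addrC subrK /absc.
  rewrite /= /psi rE -[RHS](@integral_periodic_shift _ _ _ c cI).
  - apply: eq_integral => t _; congr (G _).
    have toCI : injective (@toC R) by move=> [? ?] [? ?] [-> ->].
    by apply: toCI; rewrite toC_rot toC_polar {1}pE (addrC t) expiD mulrA.
  - apply: (measurableT_comp mG); apply/measurable_fun_pairP; split => /=.
      by apply: measurable_funM => //; exact: measurable_cosT.
    by apply: measurable_funM => //; exact: measurable_sinT.
  - by move=> x; exact: G0.
  - by move=> t; congr G; apply/pair_equal_spec; rewrite /= !mulr_natl cosD2pi sinD2pi.
have key : ((2 * pi)%:E * \int[leb2]_p G p = \int[leb2]_(p in D) psi (radial p))%E.
  rewrite [RHS]integral_mkcond -(eq_integral _ _ (fun p _ => spin p)).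
  have := @tonelli_rect _ _ T R2 R leb area I setT (fun tp => G (rot tp)).
  move=> <- //; last first.
  - by apply: (measurableT_comp mG).
  transitivity (\int[leb]_(t in I) (cst (\int[leb2]_p G p) t))%E.
    rewrite /I integral_cst//= lebesgue_measure_itv/= lte_fin pi2 -EFinB subr0.
    by rewrite muleC.
  apply: eq_integral => t _; rewrite -(@integral_rotation _ G (cos t) (sin t))//.
  exact: cos2Dsin2.
have mpr : measurable_fun setT (psi \o radial).
  by apply: (measurableT_comp mpsi); exact: measurable_radial.
have -> : (\int[dA]_(p in D) F p = \int[dA]_p G p)%E by rewrite integral_mkcond.
have dAE (H : R2 -> \bar R) (B : set R2) : measurable B -> measurable_fun B H ->
    (forall p, 0 <= H p)%E -> (\int[dA]_(p in B) H p = (pi^-1)%:E * \int[leb2]_(p in B) H p)%E.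
  by move=> mB mH H0; rewrite ge0_integral_mscale.
rewrite dAE//.
have -> : (\int[leb2]_p G p = ((2 * pi)^-1)%:E * \int[leb2]_(p in D) psi (radial p))%E.
  by rewrite -key muleA -EFinM mulVf ?gt_eqF// mul1e.
rewrite muleCA -dAE//; last exact: measurable_funTS.
congr (_ * _)%E.
rewrite /D disk_radial.
have := @ge0_integral_pushforward _ _ _ _ _ _ (@measurable_radial R) (@dA R) `]0%R, 1%R]%classic psi.
move=> <- //; last exact: measurable_funTS.
transitivity (\int[leb]_(x in `]0%R, 1%R]) psi x)%E.
  apply: eq_measure_integral; first exact: measurable_radial.
  move=> mr B mB B1; apply: pushforward_radial => // x /B1 /=.
  by rewrite !in_itv/= => /andP[].
rewrite -integral_itv_bndo_bndc; last exact: measurable_funTS.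
apply: eq_integral => x /set_mem /=; rewrite in_itv/= => /andP[x0 x1].
apply: eq_integral => t _; rewrite /G patchE mem_set//.
suff: absc (toC (polar (Num.sqrt (1 - x)) t)) < 1 by [].
rewrite toC_polar absc_rexpi ?sqrtr_ge0// -[ltRHS]sqrtr1 ltr_sqrt//.
by rewrite gtrBl.
Qed.

End PolarIntegral.

(** * Integration against a density *)

Section DensityMeasure.
Local Open Scope ereal_scope.
Context d (T : measurableType d) (R : realType).
Variables (m nu : {measure set T -> \bar R}) (D : set T) (mD : measurable D).
Variable w : T -> R.
Hypotheses (w0 : forall x, (0 <= w x)%R) (mw : measurable_fun setT w).
Hypothesis nuE : forall A, measurable A -> nu A = \int[m]_(x in A `&` D) (w x)%:E.

Import HBNNSimple.

Let integral_density_nnsfun (h : {nnsfun T >-> R}) :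
  \int[nu]_(x in D) (h x)%:E = \int[m]_(x in D) ((w x)%:E * (h x)%:E).
Proof.
have mwD : measurable_fun D (fun x => (w x)%:E).
  by apply/measurable_EFinP; exact: measurable_funTS.
under [LHS]eq_integral do rewrite fimfunE -fsumEFin//.
rewrite [LHS]ge0_integral_fsum//; last 2 first.
  - by move=> r; exact/measurable_EFinP/measurableT_comp.
  - by move=> n x _; rewrite EFinM nnfun_muleindic_ge0.
under [RHS]eq_integral.
  move=> x xD; rewrite fimfunE -fsumEFin// ge0_mule_fsumr; last first.
    by move=> r; rewrite EFinM nnfun_muleindic_ge0.
  over.
rewrite [RHS]ge0_integral_fsum//; last 2 first.
  - move=> r; apply: emeasurable_funM => //.
    by apply/measurable_EFinP; do 2 apply/measurableT_comp => //.
  - move=> n x _; apply: mule_ge0; first by rewrite lee_fin.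
    by rewrite EFinM nnfun_muleindic_ge0.
apply: eq_fsbigr => r _; rewrite integralZl_indic_nnsfun//.
have [r0|r0] := ltP r 0%R.
  rewrite preimage_nnfun0//; under [in LHS]eq_integral do rewrite indic0.
  by rewrite integral0 mule0 integral0_eq// => x _; rewrite indic0 mulr0 mule0.
pose B := h @^-1` [set r]; rewrite -/B.
have mB : measurable B by exact: measurable_sfunP.
rewrite integral_indic// nuE; last exact: measurableI.
rewrite -setIA setIid setIC integral_mkcondr.
rewrite -ge0_integralZl//.
- apply: eq_integral => x _; rewrite patchE EFinM indicE.
  by case: ifP => _; rewrite ?mule1 ?mule0// muleC.
- by apply/(measurable_restrict _ mB mD); exact: measurable_funS mwD.
- by move=> x _; rewrite patchE; case: ifP => // _; rewrite lee_fin.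
Qed.

(** True for simple functions by the formula for nu, and for nonnegative ones by
    monotone convergence on both sides. *)
Lemma ge0_integral_density (f : T -> \bar R) : measurable_fun D f ->
  (forall x, D x -> 0 <= f x) ->
  \int[nu]_(x in D) f x = \int[m]_(x in D) ((w x)%:E * f x).
Proof.
move=> mf f0; pose f_ := nnsfun_approx mD mf.
transitivity (limn (fun n => \int[nu]_(x in D) (f_ n x)%:E)).
  rewrite -monotone_convergence//=.
  - apply: eq_integral => x /[!inE] xD; apply/esym/cvg_lim => //=.
    exact: cvg_nnsfun_approx.
  - by move=> n; apply: measurableT_comp => //; exact: measurable_funTS.
  - by move=> n x _; rewrite lee_fin.
  - by move=> x _ a b ab; rewrite lee_fin//; exact/lefP/nd_nnsfun_approx.
under eq_fun do rewrite integral_density_nnsfun.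
rewrite -monotone_convergence//=.
- apply: eq_integral => x /[!inE] xD; apply/cvg_lim => //.
  by apply: cvgeZl => //; exact: cvg_nnsfun_approx.
- move=> n; apply: emeasurable_funM.
    by apply/measurable_EFinP; exact: measurable_funTS.
  by apply/measurable_EFinP/measurable_funTS.
- by move=> n x _; rewrite mule_ge0// lee_fin.
- move=> x _ a b ab; rewrite lee_wpmul2l ?lee_fin//.
  exact/lefP/nd_nnsfun_approx.
Qed.

End DensityMeasure.

(** * Beta integrals near the exponent -1 *)

Section BetaIntegral.
Context {R : realType}.
Local Notation leb := (@lebesgue_measure R).
Local Notation T := (measurableTypeR R).

Lemma measurable_powRT (c : R) (A : set T) : measurable_fun A (fun x : T => x `^ c : T).
Proof. by apply: measurable_funTS; exact: measurable_powR. Qed.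

Lemma measurable_powR_onem (c : R) (A : set T) :
  measurable_fun A (fun x : T => (1 - x) `^ c : T).
Proof.
apply: measurable_funTS; apply: (measurableT_comp (measurable_powR c)).
by apply: measurable_funB.
Qed.

(** For negative c the integrand is unbounded near 0, so the interval is
    exhausted by the segments [d / (n + 2), d]. *)
Lemma integral_powR0 (c d : R) : -1 < c -> 0 < d ->
  (\int[leb]_(x in `]0%R, d]) (x `^ c)%:E = (d `^ (c + 1) / (c + 1))%:E)%E.
Proof.
move=> c1 d0; have c10 : 0 < c + 1 by rewrite -ltrBlDr sub0r.
pose e (n : nat) : R := d / n.+2%:R.
have e0 n : 0 < e n by rewrite divr_gt0.
have ed n : e n < d by rewrite ltr_pdivrMr// ltr_pMr// ltr1n.
pose F (n : nat) : set T := `[e n, d]%classic.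
have FU : `]0, d]%classic = \bigcup_n F n :> set T.
  apply/seteqP; split => x; rewrite /F /= in_itv/=; last first.
    by move=> [n _ /=]; rewrite in_itv/= => /andP[ex ->]; rewrite (lt_le_trans (e0 n)).
  move=> /andP[x0 xd]; exists (Num.truncn (d / x)) => //=.
  rewrite in_itv/= xd andbT ler_pdivrMr// mulrC -ler_pdivrMr//.
  rewrite (le_trans (ltW (truncnS_gt _)))// ler_nat//.
have nF : nondecreasing_seq F.
  move=> n k nk; apply/subsetPset => x; rewrite /F /= !in_itv/= => /andP[nx ->].
  rewrite andbT (le_trans _ nx)// ler_pM2l// lef_pV2 ?posrE// ler_nat.
  by rewrite !ltnS.
have mF i : measurable (F i) by exact: measurable_itv.
have mf i : measurable_fun (F i) (fun x : T => (x `^ c)%:E).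
  by apply/measurable_EFinP; exact: measurable_powRT.
have cvg1 := ge0_nondecreasing_set_cvg_integral (mu := leb) nF mF mf
  (fun i x _ => powR_ge0 x c).
have val n : (\int[leb]_(x in F n) (x `^ c)%:E =
    ((d `^ (c + 1) - e n `^ (c + 1)) / (c + 1))%:E)%E.
  pose P (x : R) := x `^ (c + 1) / (c + 1).
  have dP (x : R) : 0 < x -> is_derive x (1 : R) P (x `^ c).
    move=> x0; have -> : x `^ c = (c + 1)^-1 *: ((c + 1) * x `^ (c + 1 - 1)).
      by rewrite addrK /GRing.scale/= mulrA mulVf ?gt_eqF// mul1r.
    have -> : P = (fun y => (c + 1)^-1 *: (y `^ (c + 1))).
      by apply/funext => y; rewrite /P mulrC.
    have dp := @is_derive1_powR R (c + 1) x x0; exact: is_deriveZ.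
  have Pc (x : R) : 0 < x -> {for x, continuous P}.
    by move=> /dP[xP _]; apply/differentiable_continuous/derivable1_diffP.
  rewrite (@continuous_FTC2 _ (@powR R ^~ c) P _ _ (ed n)).
  - by rewrite -EFinB mulrBl.
  - apply: continuous_in_subspaceT => x /set_mem /=; rewrite in_itv/= => /andP[ex _].
    by apply: powR_continuous; rewrite (lt_le_trans (e0 n)).
  - split => [x| |].
    + by rewrite in_itv/= => /andP[ex _]; case: (dP x (lt_trans (e0 n) ex)).
    + by apply: cvg_at_right_filter; exact: Pc.
    + by apply: cvg_at_left_filter; exact: Pc.
  - move=> x; rewrite in_itv/= => /andP[ex _]; rewrite derive1E.
    exact: (@derive_val _ _ _ _ _ _ _ (dP x (lt_trans (e0 n) ex))).
rewrite FU; apply: cvg_unique cvg1 _ => //.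
rewrite (_ : (fun n => _) = EFin \o (fun n => (d `^ (c + 1) - e n `^ (c + 1)) / (c + 1))); last first.
  by apply/funext => n; rewrite val.
apply: cvg_EFin; first by near=> n.
have ee : e n @[n --> \oo] --> (0 : R).
  have h : (@harmonic R n.+1) @[n --> \oo] --> (0 : R).
    by rewrite (cvg_shiftS (@harmonic R)); exact: cvg_harmonic.
  have := cvgM (@cvg_cst _ d nat \oo _) h; rewrite mulr0; exact.
have epow : e n `^ (c + 1) @[n --> \oo] --> (0 : R).
  apply/cvgrPdist_lt => k k0.
  have := @powR_cvg0 R (c + 1) c10.
  move=> /cvgrPdist_lt /(_ k k0) [r /= r0 rP].
  move/cvgrPdist_lt: ee => /(_ r r0); apply: filterS => n en.
  exact: rP.
have := cvgM (cvgB (@cvg_cst _ (d `^ (c + 1)) nat \oo _) epow)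
  (@cvg_cst _ (c + 1)^-1 nat \oo _).
rewrite subr0; exact.
Unshelve. all: by end_near. Qed.

Lemma integral_onem (d : R) (h : T -> \bar R) : measurable_fun setT h ->
  (forall x, 0 <= h x)%E ->
  (\int[leb]_(x in `[d, 1%R[) h (1 - x)%R = \int[leb]_(x in `]0%R, (1 - d)%R]) h x)%E.
Proof.
move=> mh h0.
have mN : measurable_fun [set: T] (-%R : T -> T) by exact: oppr_measurable.
have := @ge0_integral_pushforward _ _ _ _ _ _ mN leb `]0%R, (1 - d)%R]%classic h.
move=> /(_ _ _ _) E.
transitivity (\int[pushforward leb (-%R : T -> T)]_(x in `]0%R, (1 - d)%R]) h x)%E; last first.
  apply: eq_measure_integral => // A mA _.
  exact: lebesgue_measureN.
rewrite E//; [|exact: measurable_funTS].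
pose D : set T := `[(d - 1)%R, 0%R[%classic.
have -> : (-%R : T -> T) @^-1` `]0%R, (1 - d)%R] = D.
  apply/seteqP; split => x; rewrite /D /= !in_itv/= oppr_gt0 lerNl opprB => /andP[-> ->] //.
rewrite -(@integral_shift _ (- 1) D)//.
- have -> : [set x | D (x - 1)%R] = `[d, 1[%classic.
    apply/seteqP; split => x; rewrite /D /= !in_itv/= lerD2r subr_lt0//.
  by apply: eq_integral => x _ /=; rewrite opprB.
- exact: measurable_itv.
- by apply: measurable_funTS; apply: measurableT_comp.
- by move=> x _; exact: h0.
Qed.

Definition beta_integral (D : set T) (a b : R) : \bar R :=
  (\int[leb]_(x in D) (x `^ a * (1 - x) `^ b)%:E)%E.

Lemma beta_integrand_ge0 (a b x : R) : 0 <= x `^ a * (1 - x) `^ b.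
Proof. by rewrite mulr_ge0 ?powR_ge0. Qed.

Lemma measurable_beta_integrand (a b : R) (D : set T) :
  measurable_fun D (fun x : T => (x `^ a * (1 - x) `^ b)%:E).
Proof.
apply/measurable_EFinP; apply: measurable_funM.
  exact: measurable_powRT.
exact: measurable_powR_onem.
Qed.

Lemma powR_le_inv (x d a : R) : -1 <= a -> 0 < d <= x -> x <= 1 -> x `^ a <= d^-1.
Proof.
move=> a1 /andP[d0 dx] x1; have x0 : 0 < x by exact: lt_le_trans dx.
have -> : d^-1 = d `^ (-1) by rewrite powR_inv1// ltW.
apply: (@le_trans _ _ (x `^ (-1))).
  by apply: ger_powR => //; rewrite x0.
by rewrite !powR_inv1 ?(ltW d0) ?(ltW x0)// lef_pV2 ?posrE.
Qed.

(** The bound is uniform in a, because the factor x ^ a is at most 1 / d away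
    from 0. *)
Lemma beta_tail (d b a : R) : 0 < d < 1 -> -1 < b -> -1 <= a ->
  (beta_integral `[d, 1%R[ a b <= (d^-1 * ((1 - d) `^ (b + 1) / (b + 1)))%:E)%E.
Proof.
move=> /andP[d0 d1] b1 a1.
have := @integral_onem d (fun x => (x `^ b)%:E).
rewrite integral_powR0 ?subr_gt0// => E.
rewrite EFinM -E; last 2 first.
- by apply/measurable_EFinP; exact: measurable_powRT.
- by move=> x; rewrite lee_fin powR_ge0.
rewrite -ge0_integralZl_EFin//.
- apply: ge0_le_integral => //.
  + by move=> x _; rewrite lee_fin beta_integrand_ge0.
  + exact: measurable_beta_integrand.
  + apply: emeasurable_funM => //; apply/measurable_EFinP; exact: measurable_powR_onem.
  + move=> x /=; rewrite in_itv/= => /andP[dx x1]; rewrite lee_fin.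
    by rewrite ler_wpM2r ?powR_ge0// powR_le_inv ?d0 ?(ltW x1).
- by move=> x _; rewrite lee_fin powR_ge0.
- by apply/measurable_EFinP; exact: measurable_powR_onem.
- by rewrite invr_ge0 ltW.
Qed.

Lemma beta_split (d a b : R) : 0 < d < 1 ->
  (beta_integral `]0%R, 1%R[ a b =
   beta_integral `]0%R, d[ a b + beta_integral `[d, 1%R[ a b)%E.
Proof.
move=> /andP[d0 d1]; rewrite /beta_integral -ge0_integral_setU//=.
- by rewrite -itv_bndbnd_setU// bnd_simp ltW.
- exact: measurable_beta_integrand.
- by move=> x _; rewrite lee_fin beta_integrand_ge0.
- apply/disj_setPS => x /= []; rewrite !in_itv/= => /andP[_ xb] /andP[bx _].
  by move: (lt_le_trans xb bx); rewrite ltxx.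
Qed.

Lemma beta_integral_fin (a b : R) : -1 < a -> -1 < b ->
  (beta_integral `]0%R, 1%R[ a b < +oo)%E.
Proof.
move=> a1 b1; have h01 : 0 < (2^-1 : R) < 1 by rewrite invr_gt0 ltr0n invf_lt1 ?ltr1n.
have [h0 h1] := andP h01.
rewrite (beta_split _ _ h01) lte_add_pinfty//; last first.
  by rewrite (le_lt_trans (beta_tail h01 b1 (ltW a1))) ?ltry.
apply: (@le_lt_trans _ _ (2%:E * \int[leb]_(x in `]0%R, 2^-1%R]) (x `^ a)%:E)%E); last first.
  by rewrite integral_powR0// -EFinM ltry.
rewrite -ge0_integralZl_EFin//.
- apply: (@le_trans _ _ (\int[leb]_(x in `]0%R, 2^-1%R[) (2%:E * (x `^ a)%:E))%E).
    apply: ge0_le_integral => //.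
    + by move=> x _; rewrite lee_fin beta_integrand_ge0.
    + exact: measurable_beta_integrand.
    + by apply: emeasurable_funM => //; apply/measurable_EFinP; exact: measurable_powRT.
    + move=> x /=; rewrite in_itv/= => /andP[x0 xh]; rewrite -EFinM lee_fin mulrC.
      rewrite ler_wpM2r ?powR_ge0// -[leRHS]invrK powR_le_inv ?(ltW b1)//.
        rewrite h0/=; lra.
      by rewrite gerBl ltW.
  apply: ge0_subset_integral => //.
  + by apply: emeasurable_funM => //; apply/measurable_EFinP; exact: measurable_powRT.
  + by move=> x _; rewrite -EFinM lee_fin mulr_ge0 ?powR_ge0.
  + by apply: subset_itvl; rewrite bnd_simp.
- by move=> x _; rewrite lee_fin powR_ge0.
- by apply/measurable_EFinP; exact: measurable_powRT.
Qed.

(** On ]0, 1 / 2] the factor (1 - x) ^ b is bounded below, and the integral of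
    x ^ a over this interval is at least 1 / (2 * (a + 1)) when a <= 0. *)
Lemma beta_integral_blowup (b A : R) : exists2 d : R, 0 < d <= 1 &
  forall a, -1 < a < -1 + d -> (A%:E <= beta_integral `]0%R, 1%R[ a b)%E.
Proof.
pose m := 2^-1 `^ `|b|; have m0 : 0 < m by rewrite powR_gt0// invr_gt0.
pose B := Num.max A 1; have B0 : 0 < B by rewrite lt_max ltr01 orbT.
exists (Num.min 1 (m / 2 / B)); first by rewrite lt_min ltr01 !divr_gt0//= ge_min lexx.
move=> a /andP[a1]; rewrite -ltrBlDl opprK lt_min => /andP[a0 am].
have a10 : 0 < a + 1 by rewrite -ltrBlDr sub0r.
apply: (@le_trans _ _ (m%:E * \int[leb]_(x in `]0%R, 2^-1%R]) (x `^ a)%:E)%E).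
  rewrite integral_powR0 ?invr_gt0// -EFinM lee_fin mulrA ler_pdivlMr//.
  have : 2^-1 <= 2^-1 `^ (a + 1) :> R.
    rewrite -{1}[2^-1]powRr1 ?invr_ge0// ger_powR//; last exact: ltW.
    by rewrite invr_gt0 ltr0n invf_le1// ler1n.
  move=> h; apply: (@le_trans _ _ (m / 2)); last by rewrite ler_wpM2l// ltW.
  move: am; rewrite ltr_pdivlMr// => am; rewrite (le_trans _ (ltW am))// mulrC.
  by rewrite ler_wpM2l ?(ltW a10)// le_max lexx.
rewrite -ge0_integralZl_EFin//.
- apply: (@le_trans _ _ (beta_integral `]0%R, 2^-1%R] a b)).
    apply: ge0_le_integral => //.
    + by move=> x _; rewrite -EFinM lee_fin mulr_ge0 ?powR_ge0// ltW.
    + by apply: emeasurable_funM => //; apply/measurable_EFinP; exact: measurable_powRT.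
    + exact: measurable_beta_integrand.
    + move=> x /=; rewrite in_itv/= => /andP[x0 xh]; rewrite -EFinM lee_fin mulrC.
      rewrite ler_wpM2l ?powR_ge0//.
      have h1 : 2^-1 <= 1 - x by lra.
      have h2 : 0 < 1 - x <= 1 by apply/andP; split; lra.
      apply: (@le_trans _ _ ((1 - x) `^ `|b|)).
        by rewrite /m ge0_ler_powR ?nnegrE ?invr_ge0//; case/andP: h2 => /ltW.
      by apply: ger_powR => //; exact: ler_norm.
  apply: ge0_subset_integral => //.
  + exact: measurable_beta_integrand.
  + by move=> x _; rewrite lee_fin beta_integrand_ge0.
  + by apply: subset_itvl; rewrite bnd_simp invf_lt1// ltr1n.
- by move=> x _; rewrite lee_fin powR_ge0.
- by apply/measurable_EFinP; exact: measurable_powRT.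
- exact: ltW.
Qed.

End BetaIntegral.

(** * The Bergman integral as a weighted integral of circle means *)

Section BergmanPolar.
Context {R : realType}.
Local Notation C := (R[i]).
Local Notation leb := (@lebesgue_measure R).
Local Notation T := (measurableTypeR R).
Local Notation R2 := (T * T)%type.

(** A removable singularity is the case n = 0, which lets poles and removable
    singularities be treated alike from here on. *)
Lemma sing_order_factor (f : C -> C) (n : nat) : sing_order f n ->
  exists g : C -> C, (forall z, absc z < 1 -> exists d, cderiv g z d) /\
    forall z, pdisk z -> f z = g z / z ^+ n.
Proof.
have hD g : holomorphic disk g -> forall z : C, absc z < 1 -> exists d, cderiv g z d.
  by move=> gh z z1; exact: derivable_cderiv (gh z z1).
case: n => [[g gh fg]|n [g [gh _ fg]]]; exists g; split => //; try exact: hD.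
by move=> z /fg ->; rewrite expr0 divr1.
Qed.

(** The subtraction of 1 when 2 * (beta + 1) / s is a natural number makes the
    inequality strict in both cases. *)
Lemma eta_boundP (s beta : R) (n : nat) : 0 < s ->
  n%:Z <= eta_bound s beta -> s * n%:R < 2 * (beta + 1).
Proof.
move=> s0; rewrite /eta_bound [s * _]mulrC -ltr_pdivlMr//.
set q := 2 * (beta + 1) / s; case: ifPn => [/natrP[k kE]|qN].
  rewrite kE (_ : Num.floor k%:R = k%:Z :> int); last first.
    by apply: floor_def; rewrite intrD -pmulrn lexx ltrDl ltr01.
  by rewrite lerBrDr lezD1 ltz_nat ltr_nat.
rewrite floor_ge_int -pmulrn => nq; rewrite lt_neqAle nq andbT.
by apply: contra qN => /eqP <-; apply/natrP; exists n.
Qed.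

Variables (s beta : R) (f g : C -> C) (n : nat).
Hypothesis f_hol : holomorphic pdisk f.
Hypothesis gD : forall z, absc z < 1 -> exists d, cderiv g z d.
Hypothesis fg : forall z, pdisk z -> f z = g z / z ^+ n.

Let gam : R := beta - s * n%:R / 2.

Lemma pdisk_circle (r t : R) : 0 < r < 1 -> pdisk (r%:C * expi t).
Proof.
move=> /andP[r0 r1]; have rt : absc (r%:C * expi t) = r by rewrite absc_rexpi// ltW.
split; first by have : absc (r%:C * expi t) < 1 by rewrite rt.
by move=> rt0; move: r0; rewrite -rt rt0 absc0 ltxx.
Qed.

Lemma absc_factor (r t : R) : 0 < r < 1 ->
  absc (f (r%:C * expi t)) `^ s =
  r `^ (- (s * n%:R)) * absc (g (r%:C * expi t)) `^ s.
Proof.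
move=> r01; have [r0 r1] := andP r01.
rewrite fg; last exact: pdisk_circle.
rewrite abscM abscV abscX absc_rexpi ?(ltW r0)//.
rewrite mulrC powRM ?invr_ge0 ?exprn_ge0 ?absc_ge0 ?(ltW r0)//; congr (_ * _).
rewrite -powR_inv1 ?exprn_ge0 ?(ltW r0)// -powR_mulrn ?(ltW r0)//.
by rewrite -!powRrM; congr (_ `^ _); ring.
Qed.

Lemma circle_mean_factor (r : R) : 0 < r < 1 -> Defs.eta f = n ->
  circle_mean s f r = (((2 * pi)^-1)%:E * power_mean g s r)%E.
Proof.
move=> r01 en; have [r0 r1] := andP r01; rewrite /circle_mean /power_mean en.
under eq_integral do rewrite (absc_factor _ r01) EFinM.
rewrite ge0_integralZl_EFin ?powR_ge0//.
- rewrite muleA -EFinM; congr (_%:E * _)%E.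
  rewrite mulrAC -powRD ?subrr ?powRr0 ?mul1r//.
  by apply/implyP => _; rewrite gt_eqF.
- by move=> t _; rewrite lee_fin powR_ge0.
- apply/measurable_EFinP; apply: measurable_funTS.
  by apply: measurable_circle_powR => //; rewrite ger0_norm ?(ltW r0).
Qed.

Lemma measurable_bergman_integrand :
  measurable_fun (toC @^-1` disk : set R2) (fun p : R2 => absc (f (toC p)) `^ s : T).
Proof.
apply: (measurableT_comp (measurable_powR s)).
have m0 : measurable [set ((0, 0) : R2)].
  have -> : [set ((0, 0) : R2)] = [set (0 : T)] `*` [set (0 : T)].
    by apply/seteqP; split => [[x y] /= [-> ->]//|[x y] /= [-> ->]].
  by apply: measurableX; exact: measurable_set1.
have op z : pdisk z -> exists2 d : R, 0 < d & forall w, absc (w - z) < d -> pdisk w.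
  move=> [z1 /= /eqP z0]; rewrite -absc_gt0 in z0.
  exists (Num.min (absc z) (1 - absc z)).
    by rewrite lt_min z0 subr_gt0.
  move=> w; rewrite lt_min => /andP[w1 w2]; split => /=.
    by rewrite /disk /=; have := le_abscB w z; lra.
  by move=> w0; move: w1; rewrite w0 sub0r abscN ltxx.
have mP : measurable_fun (toC @^-1` pdisk : set R2) ((fun z => absc (f z)) \o toC).
  apply: measurable_ccont => // z zp e e0.
  have [d fd] := derivable_cderiv (f_hol zp).
  have [k k0 kP] := cderiv_ccont fd e0; exists k => // w /kP.
  exact: le_lt_trans (le_norm_abscB _ _).
have mpd : measurable (toC @^-1` pdisk : set R2).
  apply: measurable_open_plane => -[x y] /op[d d0 dP].
  exists (d / 2); first by rewrite divr_gt0.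
  move=> [x' y'] /= xd yd; apply: dP.
  by rewrite (le_lt_trans (absc_le_ReIm _))//= [d]splitr ltrD.
have -> : (toC @^-1` disk : set R2) = (toC @^-1` pdisk) `|` [set ((0, 0) : R2)].
  apply/seteqP; split => [[x y] /= xy1|[x y] /= [[]//|[-> ->]]].
    have [xy0|xy0] := eqVneq (toC (x, y)) 0; last by left; split => //; exact/eqP.
    by right; case: xy0 => -> ->.
  by have : absc (0 : C) < 1 by rewrite absc0.
by apply/measurable_funU => //; split => //; exact: measurable_fun_set1.
Qed.

Definition bergman_int (alpha : R) : \bar R :=
  (\int[mu alpha beta]_(p in toC @^-1` disk) (absc (f (toC p)) `^ s)%:E)%E.

(** The measurability of psi comes from its being an integral over the angle;
    the formula on ]0, 1[ alone would not give it. *)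
Lemma bergman_int_polar (alpha : R) : exists psi : T -> \bar R,
  [/\ measurable_fun setT psi,
      forall x, (0 <= psi x)%E,
      forall x : R, 0 < x < 1 -> psi x =
        ((x `^ alpha * (1 - x) `^ gam / betaf (alpha + 1) (beta + 1))%:E *
          power_mean g s (Num.sqrt (1 - x)))%E &
      bergman_int alpha =
        (((2 * pi)^-1)%:E * \int[leb]_(x in `]0%R, 1%R[) psi x)%E].
Proof.
pose D : set R2 := toC @^-1` disk.
have mD : measurable D := measurable_preim_disk.
pose F : R2 -> \bar R :=
  (fun p => (mu_density alpha beta p)%:E * (absc (f (toC p)) `^ s)%:E)%E \_ D.
have mFD : measurable_fun D (fun p : R2 =>
    (mu_density alpha beta p)%:E * (absc (f (toC p)) `^ s)%:E)%E.
  apply: emeasurable_funM; apply/measurable_EFinP.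
    by apply: measurable_funTS; exact: measurable_mu_density.
  exact: measurable_bergman_integrand.
have mF : measurable_fun setT F by apply/(measurable_restrictT _ mD).
have F0 p : (0 <= F p)%E.
  rewrite /F patchE; case: ifP => // _.
  by rewrite mule_ge0// lee_fin ?mu_density_ge0 ?powR_ge0.
exists (fun x => \int[leb]_(t in `[0%R, (2 * pi)%R]) F (polar (Num.sqrt (1 - x)) t))%E.
split.
- apply: (@measurable_partial_integral _ _ _ _ _ leb `[0%R, (2 * pi)%R]%classic
    (fun p : R2 => F (polar (Num.sqrt (1 - p.2)) p.1))) => //.
  exact: (measurableT_comp mF (@measurable_polar_radius R)).
- by move=> x; apply: integral_ge0.
- move=> x /andP[x0 x1]; set r := Num.sqrt (1 - x).
  have x10 : 0 < 1 - x by rewrite subr_gt0.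
  have r0 : 0 < r by rewrite sqrtr_gt0.
  have r2 : r ^+ 2 = 1 - x by rewrite sqr_sqrtr// ltW.
  have r1 : r < 1 by rewrite -[ltRHS]sqrtr1 ltr_sqrt// gtrBl.
  have r01 : 0 < r < 1 by rewrite r0.
  have rE a : r `^ a = (1 - x) `^ (a / 2).
    by rewrite -r2 -powR_mulrn ?(ltW r0)// -powRrM mulrC divfK.
  rewrite /power_mean -ge0_integralZl_EFin//.
  + apply: eq_integral => t _; rewrite /F patchE mem_set; last first.
      by have [] := pdisk_circle t r01; rewrite -toC_polar.
    rewrite toC_polar (absc_factor _ r01) -!EFinM; congr (_%:E).
    rewrite /mu_density toC_polar absc_rexpi ?(ltW r0)// r2.
    have -> : 1 - (1 - x) = x by ring.
    rewrite !rE.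
    have -> : 2 * beta / 2 = beta by rewrite mulrAC divff// mul1r.
    have -> : gam = beta + - (s * n%:R) / 2 by rewrite /gam mulNr.
    rewrite powRD; last by apply/implyP => _; rewrite gt_eqF.
    by ring.
  + by move=> t _; rewrite lee_fin powR_ge0.
  + apply/measurable_EFinP; apply: measurable_funTS.
    by apply: measurable_circle_powR => //; rewrite ger0_norm ?(ltW r0).
  + rewrite divr_ge0 ?mulr_ge0 ?powR_ge0 ?betaf_ge0//.
rewrite -polar_integral// /bergman_int.
rewrite (@ge0_integral_density _ _ _ (@dA R) _ D mD (mu_density alpha beta))//.
- apply: eq_integral => p pD; by rewrite /F patchE pD.
- exact: mu_density_ge0.
- exact: measurable_mu_density.
- by apply/measurable_EFinP; exact: measurable_bergman_integrand.
- by move=> p _; rewrite lee_fin powR_ge0.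
Qed.

End BergmanPolar.

(** * Concentration of the Bergman integral at the unit circle *)

Section BetaComparison.
Context {R : realType}.
Local Notation T := (measurableTypeR R).

Lemma beta_integral_ge0 (D : set T) (a b : R) : (0 <= beta_integral D a b)%E.
Proof. by apply: integral_ge0 => x _; rewrite lee_fin beta_integrand_ge0. Qed.

Lemma betafE (a b : R) : -1 < a -> -1 < b ->
  ((betaf (a + 1) (b + 1))%:E = beta_integral `]0%R, 1%R[ a b)%E.
Proof.
move=> a1 b1; rewrite /betaf !addrK /Rintegral fineK//.
by rewrite ge0_fin_numE ?beta_integral_ge0 ?beta_integral_fin.
Qed.

Lemma beta_head_ge (d a b : R) : 0 < d < 1 -> -1 < a -> -1 < b ->
  ((betaf (a + 1) (b + 1) - d^-1 * ((1 - d) `^ (b + 1) / (b + 1)))%:E <=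
   beta_integral `]0%R, d[ a b)%E.
Proof.
move=> d01 a1 b1; rewrite EFinB betafE// (beta_split _ _ d01) leeBlDr//.
by rewrite leeD2l// beta_tail// ltW.
Qed.

(** On ]0, d[ lowering the exponent of 1 - x from b to c costs at most a factor
    close to 1, and the rest of the integral stays bounded. *)
Lemma beta_integral_le (d a b c : R) : 0 < d < 1 -> -1 < a -> -1 < c -> c <= b ->
  (beta_integral `]0%R, 1%R[ a c <=
   ((1 - d) `^ (c - b) * betaf (a + 1) (b + 1) +
    d^-1 * ((1 - d) `^ (c + 1) / (c + 1)))%:E)%E.
Proof.
move=> d01 a1 c1 cb; have [d0 d1] := andP d01.
have b1 : -1 < b by exact: lt_le_trans cb.
rewrite (beta_split _ _ d01) EFinD.
apply: leeD; last exact: (beta_tail d01 c1 (ltW a1)).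
rewrite EFinM betafE//.
apply: (@le_trans _ _ (((1 - d) `^ (c - b))%:E * beta_integral `]0%R, d[ a b)%E).
  rewrite /beta_integral -ge0_integralZl_EFin ?powR_ge0//.
  - apply: ge0_le_integral => //.
    + by move=> x _; rewrite lee_fin beta_integrand_ge0.
    + exact: measurable_beta_integrand.
    + by apply: emeasurable_funM => //; exact: measurable_beta_integrand.
    + move=> x /=; rewrite in_itv/= => /andP[x0 xd].
      rewrite -EFinM lee_fin mulrCA ler_wpM2l ?powR_ge0//.
      have x1 : 0 < 1 - x by rewrite subr_gt0 (lt_trans xd).
      have -> : (1 - x) `^ c = (1 - x) `^ (c - b) * (1 - x) `^ b.
        by rewrite -powRD ?subrK//; apply/implyP => _; rewrite gt_eqF.
      rewrite ler_wpM2r ?powR_ge0// -(opprB b c) !powRN.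
      rewrite lef_pV2 ?posrE ?powR_gt0 ?subr_gt0 ?(lt_trans xd d1)//.
      rewrite ge0_ler_powR ?nnegrE ?subr_ge0 ?(ltW d1) ?(ltW (lt_trans xd d1))//.
      by rewrite lerD2l lerN2 ltW.
  - by move=> x _; rewrite lee_fin beta_integrand_ge0.
  - exact: measurable_beta_integrand.
rewrite lee_wpmul2l ?lee_fin ?powR_ge0// (beta_split _ _ d01).
by rewrite leeDl// beta_integral_ge0.
Qed.

End BetaComparison.

Section BergmanLimit.
Context {R : realType}.
Local Notation C := (R[i]).
Local Notation leb := (@lebesgue_measure R).
Variables (s beta : R) (f g : C -> C) (n : nat).
Hypotheses (s0 : 0 < s) (beta1 : -1 < beta).
Hypothesis f_hol : holomorphic pdisk f.
Hypothesis gD : forall z, absc z < 1 -> exists d, cderiv g z d.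
Hypothesis fg : forall z, pdisk z -> f z = g z / z ^+ n.
Hypothesis sn : s * n%:R < 2 * (beta + 1).
Variable sigma : R.
Hypothesis sigma0 : 0 <= sigma.
Hypothesis mean_le : forall r, 0 < r < 1 ->
  (((2 * pi)^-1)%:E * power_mean g s r <= sigma%:E)%E.
Hypothesis mean_sup : forall e, 0 < e -> exists2 r, 0 < r < 1 &
  ((sigma - e)%:E <= ((2 * pi)^-1)%:E * power_mean g s r)%E.

Let gam : R := beta - s * n%:R / 2.
Local Notation B alpha := (betaf (alpha + 1) (beta + 1)).
Local Notation I := (bergman_int s beta f).

Let gam1 : -1 < gam.
Proof.
have : s * n%:R / 2 < beta + 1 by rewrite ltr_pdivrMr// [ltRHS]mulrC.
rewrite /gam; lra.
Qed.

Let gam_le : gam <= beta.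
Proof. by rewrite gerBl divr_ge0// mulr_ge0// ltW. Qed.

Let pi2 : 0 < 2 * pi :> R.
Proof. by rewrite mulr_gt0// pi_gt0. Qed.

Let power_mean_ge0 (r : R) : (0 <= power_mean g s r)%E.
Proof. by apply: integral_ge0 => t _; rewrite lee_fin powR_ge0. Qed.

Let scaleK (P : \bar R) : P = ((2 * pi)%:E * (((2 * pi)^-1)%:E * P))%E.
Proof. by rewrite muleA -EFinM mulfV ?gt_eqF// mul1e. Qed.

(** All circle means are at most sigma. *)
Lemma bergman_int_le (alpha : R) : -1 < alpha ->
  (I alpha <= (sigma / B alpha)%:E * beta_integral `]0%R, 1%R[ alpha gam)%E.
Proof.
move=> a1.
have [psi [mpsi psi0 psiE ->]] := bergman_int_polar s beta f_hol gD fg alpha.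
have B0 : 0 <= B alpha := betaf_ge0 _ _.
have sE : sigma / B alpha = (2 * pi)^-1 * (2 * pi * sigma / B alpha).
  by rewrite -(mulrA (2 * pi)) mulKf ?gt_eqF.
rewrite sE EFinM -muleA lee_wpmul2l ?lee_fin ?invr_ge0 ?(ltW pi2)//.
have c0 : 0 <= 2 * pi * sigma / B alpha by rewrite divr_ge0// mulr_ge0// ltW.
rewrite /beta_integral -ge0_integralZl_EFin//.
- apply: ge0_le_integral => //.
  + exact: measurable_funTS.
  + by apply: emeasurable_funM => //; exact: measurable_beta_integrand.
  + move=> x /=; rewrite in_itv/= => x01; rewrite psiE// -/gam.
    have [x0 x1] := andP x01.
    have r01 : 0 < Num.sqrt (1 - x) < 1.
      by rewrite sqrtr_gt0 subr_gt0 x1 -[ltRHS]sqrtr1 ltr_sqrt// gtrBl.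
    apply: (@le_trans _ _ ((x `^ alpha * (1 - x) `^ gam / B alpha)%:E *
        (2 * pi * sigma)%:E)%E).
      rewrite lee_wpmul2l ?lee_fin ?divr_ge0 ?beta_integrand_ge0//.
      rewrite [leLHS]scaleK (EFinM (2 * pi)) lee_wpmul2l ?lee_fin ?(ltW pi2)//.
      exact: mean_le.
    by rewrite -!EFinM lee_fin le_eqVlt; apply/orP; left; apply/eqP; ring.
- by move=> x _; rewrite lee_fin beta_integrand_ge0.
- exact: measurable_beta_integrand.
Qed.

(** By monotonicity a lower bound of one circle mean holds on all larger circles,
    that is, for x below d; there 1 - x < 1 allows raising the exponent to
    beta. *)
Lemma bergman_int_ge (alpha d v : R) : -1 < alpha -> 0 < d < 1 -> 0 <= v ->
  (v%:E <= ((2 * pi)^-1)%:E * power_mean g s (Num.sqrt (1 - d)))%E ->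
  ((v / B alpha)%:E * beta_integral `]0%R, d[ alpha beta <= I alpha)%E.
Proof.
move=> a1 /andP[d0 d1] v0 vP.
have [psi [mpsi psi0 psiE ->]] := bergman_int_polar s beta f_hol gD fg alpha.
have B0 : 0 <= B alpha := betaf_ge0 _ _.
have vE : v / B alpha = (2 * pi)^-1 * (2 * pi * v / B alpha).
  by rewrite -(mulrA (2 * pi)) mulKf ?gt_eqF.
rewrite vE EFinM -muleA lee_wpmul2l ?lee_fin ?invr_ge0 ?(ltW pi2)//.
have c0 : 0 <= 2 * pi * v / B alpha by rewrite divr_ge0// mulr_ge0// ltW.
apply: (@le_trans _ _ (\int[leb]_(x in `]0%R, d[) psi x)%E); last first.
  apply: ge0_subset_integral => //; first exact: measurable_funTS.
  by apply: subset_itvl; rewrite bnd_simp ltW.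
rewrite /beta_integral -ge0_integralZl_EFin//.
- apply: ge0_le_integral => //.
  + by move=> x _; rewrite -EFinM lee_fin mulr_ge0 ?beta_integrand_ge0.
  + by apply: emeasurable_funM => //; exact: measurable_beta_integrand.
  + exact: measurable_funTS.
  + move=> x /=; rewrite in_itv/= => /andP[x0 xd].
    have x1 : x < 1 by exact: lt_trans d1.
    have x01 : 0 < x < 1 by rewrite x0.
    rewrite (psiE x x01) -/gam.
    have x10 : 0 < 1 - x by rewrite subr_gt0.
    have mono : (power_mean g s (Num.sqrt (1 - d)) <= power_mean g s (Num.sqrt (1 - x)))%E.
      apply: power_mean_mono => //.
        by rewrite sqrtr_ge0/= ler_wsqrtr// lerD2l lerN2 ltW.
      by rewrite -[ltRHS]sqrtr1 ltr_sqrt// gtrBl.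
    apply: (@le_trans _ _ ((x `^ alpha * (1 - x) `^ gam / B alpha)%:E *
        (2 * pi * v)%:E)%E); last first.
      rewrite lee_wpmul2l ?lee_fin ?divr_ge0 ?beta_integrand_ge0//.
      apply: le_trans mono; rewrite [leRHS]scaleK (EFinM (2 * pi)).
      by rewrite lee_wpmul2l ?lee_fin ?(ltW pi2).
    rewrite -!EFinM lee_fin.
    apply: (@le_trans _ _ (2 * pi * v / B alpha * (x `^ alpha * (1 - x) `^ gam))).
      rewrite ler_wpM2l// ler_wpM2l ?powR_ge0//.
      by apply: ger_powR => //; rewrite x10/= gerBl ltW.
    by rewrite le_eqVlt; apply/orP; left; apply/eqP; ring.
- by move=> x _; rewrite lee_fin beta_integrand_ge0.
- exact: measurable_beta_integrand.
Qed.

Lemma bergman_int_fin (alpha : R) : -1 < alpha -> (I alpha < +oo)%E.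
Proof.
move=> a1; apply: le_lt_trans (bergman_int_le a1) _.
have := beta_integral_fin a1 gam1; have := beta_integral_ge0 `]0%R, 1%R[%classic alpha gam.
by case: (beta_integral _ _ _) => [r _ _||]//; rewrite -EFinM ltry.
Qed.

Lemma bergman_int_ge0 (alpha : R) : (0 <= I alpha)%E.
Proof. by apply: integral_ge0 => p _; rewrite lee_fin powR_ge0. Qed.

(** With d so small that the means on ]0, d[ are close to sigma and (1 - x) to
    the power gam - beta is close to 1, the bounds for the two parts of the
    integral are divided by a beta function that tends to infinity. *)
Lemma bergman_int_cvg (e : R) : 0 < e -> exists2 d : R, 0 < d &
  forall alpha, -1 < alpha < -1 + d -> `|fine (I alpha) - sigma| < e.
Proof.
move=> e0.
(* the errors add up to less than 2 * e1 * (sigma + 1) on either side *)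
pose e1 := e / (2 * (sigma + 1)).
have s10 : 0 < sigma + 1 by rewrite ltr_wpDl.
have e10 : 0 < e1 by rewrite divr_gt0// mulr_gt0.
have e1E : 2 * e1 * (sigma + 1) = e by rewrite /e1; field; rewrite gt_eqF.
have [r0 /andP[r00 r01] r0P] := mean_sup e10.
have [h h0 hP] := eps_continuous (@powR_continuous R (gam - beta) 1 ltr01) e10.
pose d := Num.min (1 - r0 ^+ 2) (h / 2).
have r021 : r0 ^+ 2 < 1 by rewrite expr_lt1// ltW.
have d0 : 0 < d by rewrite lt_min subr_gt0 r021 divr_gt0.
have dr : d <= 1 - r0 ^+ 2 by rewrite ge_min lexx.
have dh : d < h.
  by rewrite gt_min; apply/orP; right; rewrite ltr_pdivrMr// mulr_natr mulr2n ltrDl.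
have d1 : d < 1 by rewrite (le_lt_trans dr)// gtrBl exprn_gt0.
have d01 : 0 < d < 1 by rewrite d0.
have dP : (1 - d) `^ (gam - beta) <= 1 + e1.
  have := hP (1 - d); rewrite addrAC subrr add0r normrN gtr0_norm// => /(_ dh).
  rewrite powR1 => A; have := le_lt_trans (ler_norm _) A.
  by rewrite ltrBlDl => /ltW.
have r0d : r0 <= Num.sqrt (1 - d).
  have r0E : r0 = Num.sqrt (r0 ^+ 2) by rewrite sqrtr_sqr gtr0_norm.
  by rewrite [leLHS]r0E ler_wsqrtr// lerBrDr addrC -lerBrDr.
(* truncated at 0 because [bergman_int_ge] needs a nonnegative lower bound *)
pose v := Num.max (sigma - e1) 0.
have v0 : 0 <= v by rewrite le_max lexx orbT.
have v1 : sigma - e1 <= v by rewrite le_max lexx.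
have vs : v <= sigma by rewrite ge_max sigma0 gerBl ltW.
have vP : (v%:E <= ((2 * pi)^-1)%:E * power_mean g s (Num.sqrt (1 - d)))%E.
  rewrite /v EFin_max ge_max; apply/andP; split; last first.
    by rewrite mule_ge0// lee_fin invr_ge0 ltW.
  apply: le_trans r0P _; apply: lee_wpmul2l.
    by rewrite lee_fin invr_ge0 ltW.
  apply: power_mean_mono => //; first by rewrite (ltW r00).
  by rewrite -[ltRHS]sqrtr1 ltr_sqrt// gtrBl.
pose K1 := d^-1 * ((1 - d) `^ (gam + 1) / (gam + 1)).
pose K2 := d^-1 * ((1 - d) `^ (beta + 1) / (beta + 1)).
pose K := Num.max (Num.max K1 K2) 1.
have K0 : 0 < K by rewrite lt_max ltr01 orbT.
have K1K : K1 <= K by rewrite !le_max lexx.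
have K2K : K2 <= K by rewrite !le_max lexx orbT.
have [k /andP[k0 k1] kP] := beta_integral_blowup beta (K / e1).
exists k => // a ak; have [a1 _] := andP ak.
have := kP a ak; rewrite -betafE// lee_fin.
have hi := beta_integral_le d01 a1 gam1 gam_le.
have lo := beta_head_ge d01 a1 beta1.
have Ile := bergman_int_le a1.
have Ige := bergman_int_ge a1 d01 v0 vP.
move: hi lo Ile Ige; rewrite -/K1 -/K2; set b := B a => hi lo Ile Ige Kb.
have b0 : 0 < b by rewrite (lt_le_trans _ Kb)// divr_gt0.
have Kbe : K / b <= e1 by rewrite ler_pdivrMr// mulrC -ler_pdivrMr.
have IE : I a = (fine (I a))%:E.
  by rewrite fineK// ge0_fin_numE ?bergman_int_ge0 ?bergman_int_fin.
have up : fine (I a) <= sigma * (1 + e1 + e1).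
  have := le_trans Ile (lee_wpmul2l _ hi); rewrite lee_fin => /(_ (divr_ge0 sigma0 (ltW b0))).
  rewrite IE -EFinM lee_fin => /le_trans; apply.
  rewrite -mulrA ler_wpM2l// mulrDr mulrCA mulVf ?gt_eqF// mulr1 lerD//.
  by rewrite mulrC (le_trans _ Kbe)// ler_pM2r ?invr_gt0.
have dn : v * (1 - e1) <= fine (I a).
  have := le_trans (lee_wpmul2l _ lo) Ige; rewrite lee_fin => /(_ (divr_ge0 v0 (ltW b0))).
  rewrite IE -EFinM lee_fin; apply: le_trans.
  rewrite -mulrA ler_wpM2l// mulrBr mulVf ?gt_eqF// lerD2l lerN2.
  by rewrite mulrC (le_trans _ Kbe)// ler_pM2r ?invr_gt0.
have e1s : e1 * v <= e1 * sigma by rewrite ler_wpM2l// ltW.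
rewrite ltr_norml; apply/andP; split.
  have : v - e1 * v <= fine (I a) by rewrite mulrBr mulr1 mulrC in dn.
  have : 0 <= e1 * sigma by rewrite mulr_ge0// ltW.
  lra.
have : fine (I a) <= sigma + 2 * (e1 * sigma).
  by rewrite (le_trans up)// le_eqVlt; apply/orP; left; apply/eqP; ring.
lra.
Qed.

End BergmanLimit.

(** * Convergence of the Bergman norms *)

Section FinalLimit.
Context {R : realType}.

Lemma powR_ge0_continuous (q a e : R) : 0 < q -> 0 <= a -> 0 < e ->
  exists2 d : R, 0 < d &
    forall x, 0 <= x -> `|x - a| < d -> `|x `^ q - a `^ q| < e.
Proof.
move=> q0; rewrite le_eqVlt => /predU1P[<- e0|a0 e0]; last first.
  have [d d0 dP] := eps_continuous (@powR_continuous R q a a0) e0.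
  by exists d => // x _; exact: dP.
exists (e `^ q^-1); first by rewrite powR_gt0.
move=> x x0; rewrite subr0 ger0_norm// => xe.
rewrite powR0 ?gt_eqF// subr0 ger0_norm ?powR_ge0//.
rewrite -[ltRHS]powRr1 ?(ltW e0)// -[X in e `^ X](mulVf (lt0r_neq0 q0)) powRrM.
by rewrite gt0_ltr_powR// nnegrE// powR_ge0.
Qed.

End FinalLimit.
Local Close Scope complex_scope.

Theorem lemma3 (R : realType) (s beta : R) (f : complex R -> complex R)
    (s_gt0 : 0 < s) (beta_gt : -1 < beta) (fH : hardy s beta f) :
  (forall alpha : R, -1 < alpha -> bergman s alpha beta f) /\
  bergman_norm s alpha beta f @[alpha --> (-1 : R)^'+] --> hardy_norm s f.
Proof.
have [f_hol f_sing f_eta f_fin] := fH.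
have [g [gD fg]] := sing_order_factor f_sing.
have sn := eta_boundP s_gt0 f_eta.
have sV0 : 0 < s^-1 by rewrite invr_gt0.
pose S := ereal_sup [set circle_mean s f r | r in `]0, 1[].
have cmE r : 0 < r < 1 ->
    circle_mean s f r = (((2 * pi)^-1)%:E * power_mean g s r)%E.
  by move=> r01; exact: (circle_mean_factor s gD fg r01 erefl).
have cm_le r : 0 < r < 1 -> (circle_mean s f r <= S)%E.
  by move=> r01; apply: ereal_sup_ubound; exists r => //=; rewrite in_itv.
have S0 : (0 <= S)%E.
  have h01 : 0 < (2^-1 : R) < 1 by rewrite invr_gt0 ltr0n invf_lt1 ?ltr1n.
  apply: le_trans (cm_le _ h01); rewrite cmE// mule_ge0//.
    by rewrite lee_fin invr_ge0 mulr_ge0// pi_ge0.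
  by apply: integral_ge0 => t _; rewrite lee_fin powR_ge0.
have Sfin : (S < +oo)%E by apply: lty_poweRy f_fin; rewrite gt_eqF.
have SE : S = (fine S)%:E by rewrite fineK// ge0_fin_numE.
have sigma0 : 0 <= fine S by exact: fine_ge0.
have mean_le r : 0 < r < 1 ->
    (((2 * pi)^-1)%:E * power_mean g s r <= (fine S)%:E)%E.
  by move=> r01; rewrite -SE -cmE// cm_le.
have mean_sup e : 0 < e -> exists2 r, 0 < r < 1 &
    ((fine S - e)%:E <= ((2 * pi)^-1)%:E * power_mean g s r)%E.
  move=> e0; have : ((fine S - e)%:E < S)%E by rewrite SE lte_fin gtrBl.
  move=> /ereal_sup_gt[_ [r /= + <-]]; rewrite in_itv/= => r01 lt_r.
  by exists r => //; rewrite -cmE// ltW.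
have normE alpha : bergman_norm s alpha beta f = (bergman_int s beta f alpha `^ s^-1)%E by [].
have I_fin alpha : -1 < alpha -> (bergman_int s beta f alpha < +oo)%E.
  exact: (bergman_int_fin f_hol gD fg sn sigma0 mean_le).
split=> [alpha a1|].
  by split => //; rewrite normE poweR_lty// I_fin.
have I0 := bergman_int_ge0 s beta f.
have IE alpha : -1 < alpha ->
    bergman_int s beta f alpha = (fine (bergman_int s beta f alpha))%:E.
  by move=> a1; rewrite fineK// ge0_fin_numE ?I_fin.
have -> : hardy_norm s f = (fine S `^ s^-1)%:E.
  by rewrite /hardy_norm -/S SE poweR_EFin.
have limI : fine (bergman_int s beta f alpha) `^ s^-1 @[alpha --> (-1 : R)^'+] -->
    fine S `^ s^-1.
  apply/cvgrPdist_lt => e e0.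
  have [d d0 dP] := powR_ge0_continuous sV0 sigma0 e0.
  have [k k0 kP] := bergman_int_cvg s_gt0 beta_gt f_hol gD fg sn sigma0 mean_le mean_sup d0.
  near=> alpha; rewrite distrC; apply: dP; first exact: fine_ge0.
  apply: kP; apply/andP; split; near: alpha; first exact: nbhs_right_gt.
  by apply: nbhs_right_lt; rewrite ltrDl.
have bergman_normE alpha : -1 < alpha -> bergman_norm s alpha beta f =
    (fine (bergman_int s beta f alpha) `^ s^-1)%:E.
  by move=> a1; rewrite normE IE// poweR_EFin.
have gt_m1 : \forall alpha \near (-1 : R)^'+, -1 < alpha by exact: nbhs_right_gt.
apply/fine_cvgP; split.
  by apply: filterS gt_m1 => alpha a1; rewrite bergman_normE.
apply: cvg_trans limI; apply: near_eq_cvg.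
by apply: filterS gt_m1 => alpha a1; rewrite /= bergman_normE.
Unshelve. all: by end_near. Qed.
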